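(* Let $\Lambda=(\Lambda_0(t,z),\dots,\Lambda_l(t,z))$ be a $(\Delta,\mathbf e)$-admissible tuple of Laurent polynomials in $\mathbb Z_p[x^{\pm1}]=\mathbb Z_p[t^{\pm1},z^{\pm1}]$. Write $D_v=\frac{\partial}{\partial z_v}$. Assume that the determinants of the matrices $A(e_{i+1},\Delta_i,\Delta_{i+1},\Lambda_i(t,z))$, $i=0,1,\dots,l$, are Laurent polynomials all nonzero modulo $p$. Then for all $1\le u,v\le n$ and $1\le s\le l$, $$D_u\Big(D_v\big(A\big(\textstyle\sum_{a=1}^{s+1}e_a,\Delta_0,\Delta_{s+1},W_s\big)\big)\Big)\cdot A\big(\textstyle\sum_{a=1}^{s+1}e_a,\Delta_0,\Delta_{s+1},W_s\big)^{-1}$$ $$\equiv D_u\Big(D_v\big(A\big(\textstyle\sum_{a=1}^{s}e_a,\Delta_0,\Delta_{s},W_{s-1}\big)\big)\Big)\cdot A\big(\textstyle\sum_{a=1}^{s}e_a,\Delta_0,\Delta_{s},W_{s-1}\big)^{-1}\pmod{p^{s}}.$$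
   Context: Let $p$ be an odd prime, $t=(t_1,\dots,t_r)$ and $z=(z_1,\dots,z_n)$ two groups of variables, $x=(t,z)$. Congruence modulo $p^s$ of Laurent polynomials over $\mathbb Z_p$ means divisibility by $p^s$ of all coefficients of the difference; for matrices it is entrywise. Derivations are applied to matrices entrywise. Let $l\ge0$, let $\mathbf e=(e_1,\dots,e_{l+1})$ be positive integers and $\Delta=(\Delta_0,\dots,\Delta_{l+1})$ a tuple of nonempty finite subsets of $\mathbb Z^r$, all of the same size $g$ (each with a fixed ordering). For a Laurent polynomial $F(t,z)$ let $N(F)\subset\mathbb R^r$ be its Newton polytope with respect to the $t$ variables only. The tuple $\Lambda$ is $(\Delta,\mathbf e)$-admissible if, with $N_i=N(\Lambda_i)$, for all $0\le i\le j<l$ $$\big(\Delta_i+N_i+p^{e_{i+1}}N_{i+1}+\dots+p^{e_{i+1}+\dots+e_j}N_j\big)\cap p^{e_{i+1}+\dots+e_{j+1}}\mathbb Z^r\subset p^{e_{i+1}+\dots+e_{j+1}}\Delta_{j+1}.$$ Put $W_s(x)=\Lambda_0(x)\Lambda_1(x)^{p^{e_1}}\cdots\Lambda_s(x)^{p^{e_1+\dots+e_s}}$ for $0\le s\le l$. Hasse–Witt matrix: for $m\ge1$ and finite $\Delta',\Delta''\subset\mathbb Z^r$, $A(m,\Delta',\Delta'',F(t,z))$ is the matrix with rows indexed by $u\in\Delta'$, columns by $v\in\Delta''$, and $(u,v)$ entry the coefficient of $t^{p^mv-u}$ in $F(t,z)$ (a Laurent polynomial in $z$). Under the stated assumptions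 the determinants of the matrices being inverted are nonzero modulo $p$. A congruence $F_1F_2^{-1}\equiv G_1G_2^{-1}\pmod{p^s}$ of $g\times g$ matrices with Laurent polynomial entries, where $\det F_2,\det G_2$ are nonzero modulo $p$, is understood as follows: by Cramer's rule write $F_1F_2^{-1}=\frac1{\det F_2}F$ and $G_1G_2^{-1}=\frac1{\det G_2}G$ with $F,G$ Laurent polynomial matrices; the congruence means $F\cdot\det G_2\equiv G\cdot\det F_2\pmod{p^s}$. *)

(* Defs.v *)
From HB Require Import structures.
From mathcomp Require Import all_boot all_order all_algebra finmap.
From mathcomp Require Import boolp classical_sets reals convex.
From mathcomp.multinomials Require Import monalg.

Set Implicit Arguments.
Unset Strict Implicit.
Unset Printing Implicit Defensive.

Import Order.TTheory GRing.Theory Num.Theory.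

Local Open Scope ring_scope.

(* The ring of p-adic integers, as the inverse limit of the rings Z/p^(n+1).
   The exponent starts at 1, so that for p prime every 'Z_(p ^ n.+1) is really
   the ring of integers modulo p ^ n.+1. *)
Section PadicInt.
Variable p : nat.

Record padic_int : Type := PadicInt {
  padic_val : forall n, 'Z_(p ^ n.+1);
  padic_compat : forall n,
    padic_val n = (padic_val n.+1 : nat)%:R :> 'Z_(p ^ n.+1)
}.

HB.instance Definition _ := gen_eqMixin padic_int.
HB.instance Definition _ := gen_choiceMixin padic_int.

Lemma padicP (x y : padic_int) :
  (forall n, padic_val x n = padic_val y n) -> x = y.
Proof.
case: x y => [x xP] [y yP] /= xy.
have {}xy : x = y by apply: functional_extensionality_dep.
by subst y; rewrite (Prop_irrelevance xP yP).
Qed.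

Lemma Zp_trunc_dvd n : ((Zp_trunc (p ^ n.+1)).+2 %| (Zp_trunc (p ^ n.+2)).+2)%N.
Proof.
case: p => [|[|q]]; first by rewrite !exp0n.
  by rewrite !exp1n.
have gt1 m : (1 < q.+2 ^ m.+1)%N by rewrite -{1}(exp1n m.+1) ltn_exp2r.
by rewrite !Zp_cast // dvdn_exp2l.
Qed.

Lemma Zp_red_subproof n (a : nat) :
  (((a%:R : 'Z_(p ^ n.+2)) : nat)%:R = a%:R :> 'Z_(p ^ n.+1)).
Proof.
by rewrite !Zp_nat; apply/val_inj; rewrite /= modn_dvdm ?Zp_trunc_dvd.
Qed.

Fact padic0_subproof n :
  (0 : 'Z_(p ^ n.+1)) = ((0%R : 'Z_(p ^ n.+2)) : nat)%:R :> 'Z_(p ^ n.+1).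
Proof. by []. Qed.

Fact padic1_subproof n :
  (1 : 'Z_(p ^ n.+1)) = ((1%R : 'Z_(p ^ n.+2)) : nat)%:R :> 'Z_(p ^ n.+1).
Proof. exact: esym (Zp_red_subproof n 1). Qed.

Fact padicD_subproof (x y : padic_int) n :
  padic_val x n + padic_val y n =
    ((padic_val x n.+1 + padic_val y n.+1)%R : nat)%:R.
Proof.
rewrite -[in RHS](natr_Zp (padic_val x n.+1)) -[in RHS](natr_Zp (padic_val y n.+1)).
by rewrite -natrD Zp_red_subproof natrD -!padic_compat.
Qed.

Fact padicM_subproof (x y : padic_int) n :
  padic_val x n * padic_val y n =
    ((padic_val x n.+1 * padic_val y n.+1)%R : nat)%:R.
Proof.
rewrite -[in RHS](natr_Zp (padic_val x n.+1)) -[in RHS](natr_Zp (padic_val y n.+1)).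
by rewrite -natrM Zp_red_subproof natrM -!padic_compat.
Qed.

Fact padicN_subproof (x : padic_int) n :
  - padic_val x n = ((- padic_val x n.+1)%R : nat)%:R.
Proof.
apply/eqP; rewrite eq_sym -addr_eq0 (padic_compat x n) -natrD; apply/eqP.
by rewrite -[LHS]Zp_red_subproof natrD !natr_Zp addNr.
Qed.

Definition padic_zero := PadicInt padic0_subproof.
Definition padic_one := PadicInt padic1_subproof.
Definition padic_add x y := PadicInt (padicD_subproof x y).
Definition padic_mul x y := PadicInt (padicM_subproof x y).
Definition padic_opp x := PadicInt (padicN_subproof x).

Fact padic_addA : associative padic_add.
Proof. by move=> x y z; apply: padicP => n /=; rewrite addrA. Qed.
Fact padic_addC : commutative padic_add.
Proof. by move=> x y; apply: padicP => n /=; rewrite addrC. Qed.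
Fact padic_add0 : left_id padic_zero padic_add.
Proof. by move=> x; apply: padicP => n /=; rewrite add0r. Qed.
Fact padic_addN : left_inverse padic_zero padic_opp padic_add.
Proof. by move=> x; apply: padicP => n /=; rewrite addNr. Qed.
Fact padic_mulA : associative padic_mul.
Proof. by move=> x y z; apply: padicP => n /=; rewrite mulrA. Qed.
Fact padic_mulC : commutative padic_mul.
Proof. by move=> x y; apply: padicP => n /=; rewrite mulrC. Qed.
Fact padic_mul1 : left_id padic_one padic_mul.
Proof. by move=> x; apply: padicP => n /=; rewrite mul1r. Qed.
Fact padic_mulDl : left_distributive padic_mul padic_add.
Proof. by move=> x y z; apply: padicP => n /=; rewrite mulrDl. Qed.
Fact padic_one_neq0 : padic_one != padic_zero.
Proof. by apply/eqP => /(congr1 (fun x => padic_val x 0)) /eqP. Qed.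

HB.instance Definition _ := GRing.isZmodule.Build padic_int
  padic_addA padic_addC padic_add0 padic_addN.
HB.instance Definition _ := GRing.Zmodule_isComNzRing.Build padic_int
  padic_mulA padic_mulC padic_mul1 padic_mulDl padic_one_neq0.

End PadicInt.

(* [laurent n R] is R[x_1^{+-1}, ..., x_n^{+-1}]: the additive group is that of
   finitely supported functions on Z^n, and F@_m is the coefficient of x^m.  The
   library's product on {malg R[K]} cannot be used, as it requires a monoid K
   without nontrivial units; the convolution product is therefore built here. *)
Definition laurent (n : nat) (R : nzRingType) : Type := {malg R['rV[int]_n]}.

Section LaurentRing.
Variables (n : nat) (R : nzRingType).

HB.instance Definition _ := GRing.Lmodule.copy (laurent n R) {malg R['rV[int]_n]}.

Implicit Types (F G H : {malg R['rV[int]_n]}) (m : 'rV[int]_n).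

Definition laurent_mul F G : {malg R['rV[int]_n]} :=
  \sum_(m1 <- msupp F) \sum_(m2 <- msupp G) << F@_m1 * G@_m2 *g m1 + m2 >>.

Definition laurent_one : {malg R['rV[int]_n]} := << 1 *g 0 >>.

Lemma laurent_mulw (d1 d2 : {fset 'rV[int]_n}) F G :
  (msupp F `<=` d1)%fset -> (msupp G `<=` d2)%fset ->
  laurent_mul F G =
    \sum_(m1 <- d1) \sum_(m2 <- d2) << F@_m1 * G@_m2 *g m1 + m2 >>.
Proof.
move=> le1 le2; rewrite /laurent_mul (big_fset_incl _ le1) /=.
  apply/eq_bigr=> m1 _; apply/big_fset_incl => // k _ /mcoeff_outdom ->.
  by rewrite mulr0 monalgU0.
move=> k _ /mcoeff_outdom Fk.
by rewrite big1 => // k' _; rewrite Fk mul0r monalgU0.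
Qed.

Lemma laurent_mulUU c1 c2 m1 m2 :
  laurent_mul << c1 *g m1 >> << c2 *g m2 >> = << c1 * c2 *g m1 + m2 >>.
Proof.
by rewrite (laurent_mulw msuppU_le msuppU_le) !big_seq_fset1 !mcoeffUU.
Qed.

Lemma laurent_mul0g : left_zero 0 laurent_mul.
Proof. by move=> F; rewrite /laurent_mul msupp0 big_seq_fset0. Qed.

Lemma laurent_mulg0 : right_zero 0 laurent_mul.
Proof.
move=> F; rewrite /laurent_mul big1 // => m _.
by rewrite msupp0 big_seq_fset0.
Qed.

Fact laurent_mulDl : left_distributive laurent_mul +%R.
Proof.
move=> F G H.
rewrite [in RHS](laurent_mulw (fsubsetUl _ (msupp G)) (fsubset_refl _)).
rewrite [in RHS](laurent_mulw (fsubsetUr (msupp F) _) (fsubset_refl _)).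
rewrite (laurent_mulw (msuppD_le _ _) (fsubset_refl _)).
rewrite -big_split /=; apply/eq_bigr=> m1 _.
rewrite -big_split /=; apply/eq_bigr=> m2 _.
by rewrite mcoeffD mulrDl monalgUD.
Qed.

Fact laurent_mulDr : right_distributive laurent_mul +%R.
Proof.
move=> H F G.
rewrite [in RHS](laurent_mulw (fsubset_refl _) (fsubsetUl _ (msupp G))).
rewrite [in RHS](laurent_mulw (fsubset_refl _) (fsubsetUr (msupp F) _)).
rewrite (laurent_mulw (fsubset_refl _) (msuppD_le _ _)).
rewrite -big_split /=; apply/eq_bigr=> m1 _.
rewrite -big_split /=; apply/eq_bigr=> m2 _.
by rewrite mcoeffD mulrDr monalgUD.
Qed.

Lemma laurent_mul_suml I (s : seq I) (E : I -> {malg R['rV[int]_n]}) F :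
  laurent_mul (\sum_(i <- s) E i) F = \sum_(i <- s) laurent_mul (E i) F.
Proof.
exact: (big_morph (laurent_mul^~ F) (fun _ _ => laurent_mulDl _ _ _)
         (laurent_mul0g _)).
Qed.

Lemma laurent_mul_sumr I (s : seq I) (E : I -> {malg R['rV[int]_n]}) F :
  laurent_mul F (\sum_(i <- s) E i) = \sum_(i <- s) laurent_mul F (E i).
Proof.
exact: (big_morph (laurent_mul F) (fun _ _ => laurent_mulDr _ _ _)
         (laurent_mulg0 _)).
Qed.

Fact laurent_mulA : associative laurent_mul.
Proof.
move=> F G H; rewrite [F]monalgE [G]monalgE [H]monalgE.
rewrite !laurent_mul_suml; apply/eq_bigr => m1 _.
rewrite [in RHS](laurent_mul_sumr (msupp G)) [RHS]laurent_mul_suml.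
rewrite [LHS]laurent_mul_sumr; apply/eq_bigr => m2 _.
rewrite !laurent_mul_sumr; apply/eq_bigr => m3 _.
by rewrite !laurent_mulUU mulrA addrA.
Qed.

Fact laurent_mul1g : left_id laurent_one laurent_mul.
Proof.
move=> F; rewrite [F]monalgE laurent_mul_sumr; apply/eq_bigr => m _.
by rewrite laurent_mulUU mul1r add0r.
Qed.

Fact laurent_mulg1 : right_id laurent_one laurent_mul.
Proof.
move=> F; rewrite [F]monalgE laurent_mul_suml; apply/eq_bigr => m _.
by rewrite laurent_mulUU mulr1 addr0.
Qed.

Fact laurent_one_neq0 : laurent_one != 0.
Proof. by rewrite /laurent_one monalgU_eq0 oner_eq0. Qed.

HB.instance Definition _ := GRing.Zmodule_isNzRing.Build (laurent n R)
  laurent_mulA laurent_mul1g laurent_mulg1 laurent_mulDl laurent_mulDr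
  laurent_one_neq0.

End LaurentRing.

Section LaurentComRing.
Variables (n : nat) (R : comNzRingType).

Fact laurent_mulC : @commutative (laurent n R) _ *%R.
Proof.
move=> F G; change (laurent_mul F G = laurent_mul G F).
rewrite [LHS]exchange_big; apply/eq_bigr => m2 _; apply/eq_bigr => m1 _.
by rewrite mulrC addrC.
Qed.

HB.instance Definition _ :=
  GRing.PzRing_hasCommutativeMul.Build (laurent n R) laurent_mulC.

End LaurentComRing.

(* the partial derivative with respect to the variable of index v *)
Definition laurent_deriv (n : nat) (R : nzRingType) (v : 'I_n)
    (F : laurent n R) : laurent n R :=
  \sum_(m <- msupp F) << F@_m *~ m 0 v *g m - delta_mx 0 v >>.

(* A Laurent polynomial F(t,z) over Z_p in t = (t_1, ..., t_r) and
   z = (z_1, ..., z_n) is seen as a Laurent polynomial in t whose coefficients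
   are Laurent polynomials in z. *)
Notation laurent2 r n p := (laurent r (laurent n (padic_int p))).

Section Congruences.
Variables (p s n : nat).

Definition padic_congr (a b : padic_int p) : Prop :=
  exists c, a - b = p%:R ^+ s * c.

Definition laurent_congr (F G : laurent n (padic_int p)) : Prop :=
  forall m, padic_congr F@_m G@_m.

Definition mx_congr g1 g2 (A B : 'M[laurent n (padic_int p)]_(g1, g2)) : Prop :=
  forall i j, laurent_congr (A i j) (B i j).

End Congruences.

Definition nonzero_mod p n (F : laurent n (padic_int p)) : Prop :=
  ~ laurent_congr 1 F 0.

(* F1 * F2^-1 = G1 * G2^-1 modulo p^s, where F2^-1 and G2^-1 are given by
   Cramer's rule: F1 * F2^-1 is (\det F2)^-1 times the matrix F1 *m \adj F2. *)
Definition quotient_congr p s n g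
    (F1 F2 G1 G2 : 'M[laurent n (padic_int p)]_g) : Prop :=
  [/\ nonzero_mod (\det F2), nonzero_mod (\det G2) &
      mx_congr s (\det G2 *: (F1 *m \adj F2)) (\det F2 *: (G1 *m \adj G2))].

Definition hasse_witt p r n (m : nat) g1 g2 (D1 : g1.-tuple 'rV[int]_r)
    (D2 : g2.-tuple 'rV[int]_r) (F : laurent2 r n p) :
    'M[laurent n (padic_int p)]_(g1, g2) :=
  \matrix_(i < g1, j < g2) F@_(tnth D2 j *+ p ^ m - tnth D1 i).

Section Admissible.
Local Open Scope classical_set_scope.
Variables (R : realType) (r : nat).

Definition int_point (m : 'rV[int]_r) : 'rV[R]_r := map_mx intr m.

Definition convex_hull (X : set 'rV[R]_r) : set 'rV[R]_r :=
  smallest (@convex_set R 'rV[R]_r) X.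

Definition minkowski_sum (A B : set 'rV[R]_r) : set 'rV[R]_r :=
  [set a + b | a in A & b in B].

Definition dilate (c : nat) (A : set 'rV[R]_r) : set 'rV[R]_r :=
  [set a *+ c | a in A].

Definition newton_polytope (S : nzRingType) (F : laurent r S) : set 'rV[R]_r :=
  convex_hull [set int_point m | m in [set` msupp F]].

(* e_{i+1} + ... + e_j *)
Definition exp_sum (e : nat -> nat) (i j : nat) : nat :=
  \sum_(i.+1 <= a < j.+1) e a.

(* The tuples (e_1, ..., e_{l+1}), (Delta_0, ..., Delta_{l+1}) and
   (Lambda_0, ..., Lambda_l) are given by families indexed by nat, of which
   only the values at these indices matter. *)
Definition admissible (p n l g : nat) (Delta : nat -> g.-tuple 'rV[int]_r)
    (e : nat -> nat) (Lambda : nat -> laurent2 r n p) : Prop :=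
  forall i j : nat, (i <= j < l)%N ->
    minkowski_sum [set int_point m | m in [set` Delta i]]
      (\big[minkowski_sum/[set 0]]_(i <= k < j.+1)
         dilate (p ^ exp_sum e i k) (newton_polytope (Lambda k)))
    `&` dilate (p ^ exp_sum e i j.+1) (range int_point)
    `<=` dilate (p ^ exp_sum e i j.+1)
           [set int_point m | m in [set` Delta j.+1]].

End Admissible.

Definition dwork_product p r n (e : nat -> nat) (Lambda : nat -> laurent2 r n p)
    (s : nat) : laurent2 r n p :=
  \prod_(k < s.+1) Lambda k ^+ (p ^ exp_sum e 0 k).

(* Main.v *)
(* For i <= j put W_{i,j} = prod_{i <= k < j} Lambda_k^(p^(e_{i+1} + ... + e_k)),
   let A_{i,j} be its Hasse-Witt matrix, so that A_{j,j} = 1, and let phi_a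
   raise all variables to the power p^a.  Since F^(p^(a+b)) and
   phi_a(F)^(p^b) agree modulo p^(b+1), there is an expansion
     W_{i,j} = sum_{i < m <= j} Q_m * phi(W_{m,j}),   p^(m-i-1) | Q_m,
   whose coefficients Q_m do not depend on j and have their Newton polytope in
   N_i + ... + p^(e_{i+1} + ... + e_{m-1}) N_{m-1}.  Admissibility turns it into
   an expansion A_{i,j} = sum_m B_m * phi(A_{m,j}), and modulo p^(j-i) the
   expansion of A_{i,j+1} has the same coefficients B_m for m <= j and no other
   term.  Descending induction on i first shows that
   phi(A_{m,j+1}) * A_{i,j+1}^-1 and phi(A_{m,j}) * A_{i,j}^-1 agree modulo
   p^(j-m+1).  Then the derivatives of the expansion are compared term by term:
   what B_m lacks in divisibility is supplied by this congruence and, for the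
   derivatives of phi(A_{m,j}), by the induction hypothesis together with the
   factor p^a in D(phi_a F) = p^a z_v^(p^a - 1) phi_a(D F).  Dividing by
   determinants that are nonzero modulo p is harmless, because p generates a
   prime ideal of the ring of Laurent polynomials and is not a zero divisor. *)

Require Import Defs.
From HB Require Import structures.
From mathcomp Require Import all_boot all_order all_algebra reals finmap.
From mathcomp Require Import boolp classical_sets convex interval_inference.
From mathcomp.multinomials Require Import monalg.
From mathcomp Require Import ring zify.

Set Implicit Arguments.
Unset Strict Implicit.
Unset Printing Implicit Defensive.

Import Order.TTheory GRing.Theory Num.Theory.

Local Open Scope ring_scope.

(* Sealed so that unification does not unfold the finite-map representation. *)
HB.lock Definition lmon (n : nat) (R : nzRingType) (c : R) (m : 'rV[int]_n) :
  laurent n R := << c *g m >>.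

(** * Coefficients and monomials of Laurent polynomials *)

Section LaurentBasics.
Variables (n : nat) (R : nzRingType).
Implicit Types (F G : laurent n R) (m k : 'rV[int]_n).
Local Notation lmon := (@lmon n R).

Lemma lmon_def c m : lmon c m = << c *g m >>.
Proof. by rewrite unlock. Qed.

Lemma laurentP F G : (forall m, F@_m = G@_m) -> F = G.
Proof. by move/malgP. Qed.

Lemma lmonE F : F = \sum_(m <- msupp F) lmon F@_m m.
Proof.
by rewrite [LHS]monalgE; apply: eq_bigr => m _; rewrite lmon_def.
Qed.

Lemma lmonM a b m k : lmon a m * lmon b k = lmon (a * b) (m + k).
Proof. rewrite !lmon_def; exact: laurent_mulUU. Qed.

Lemma lmon1 : lmon 1 0 = 1. Proof. exact: lmon_def. Qed.

Lemma coef_lmon c m k : (lmon c m)@_k = c *+ (m == k).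
Proof. rewrite lmon_def; exact: mcoeffU. Qed.

Lemma coef_sum I (s : seq I) (P : pred I) (E : I -> laurent n R) m :
  (\sum_(i <- s | P i) E i)@_m = \sum_(i <- s | P i) (E i)@_m.
Proof. exact: (raddf_sum (mcoeff m)). Qed.

Lemma coefD F G m : (F + G)@_m = F@_m + G@_m.
Proof. exact: mcoeffD. Qed.
Lemma coefB F G m : (F - G)@_m = F@_m - G@_m.
Proof. exact: mcoeffB. Qed.
Lemma coef0 m : (0 : laurent n R)@_m = 0.
Proof. exact: mcoeff0. Qed.
Lemma coef1 m : (1 : laurent n R)@_m = (m == 0)%:R.
Proof. by rewrite -lmon1 coef_lmon eq_sym. Qed.

Lemma coef_lmonM c k F m : (lmon c k * F)@_m = c * F@_(m - k).
Proof.
rewrite [in LHS](lmonE F) mulr_sumr coef_sum.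
case: (msuppP F (m - k)) => [mk|out].
  rewrite (bigD1_seq (m - k)) //= ?fset_uniq // lmonM coef_lmon.
  rewrite [k + _]addrC subrK eqxx mulr1n big1 ?addr0 // => x xk.
  rewrite lmonM coef_lmon; case: eqP => // xm; case/eqP: xk.
  by rewrite -xm addrC addKr.
rewrite mulr0 big_seq big1 // => x xF; rewrite lmonM coef_lmon.
by case: eqP => // xk; move: xF; rewrite -(addrK k x) [x + k]addrC xk (negPf out).
Qed.

Lemma coefM F G m : (F * G)@_m = \sum_(k <- msupp F) F@_k * G@_(m - k).
Proof.
rewrite [in LHS](lmonE F) mulr_suml coef_sum.
by apply: eq_bigr => k _; rewrite coef_lmonM.
Qed.

Lemma coefMn F i m : (F *+ i)@_m = F@_m *+ i.
Proof. exact: mcoeffMn. Qed.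

Lemma lmonD m : {morph lmon^~ m : a b / a + b}.
Proof. move=> a b; rewrite /= !lmon_def; exact: monalgUD. Qed.

Lemma lmon0 m : lmon 0 m = 0. Proof. rewrite lmon_def; exact: monalgU0. Qed.

Lemma lmonMn c m i : lmon (c *+ i) m = lmon c m *+ i.
Proof. by elim: i => [|i IH]; rewrite ?mulr0n ?lmon0 // !mulrS lmonD IH. Qed.

Lemma lmonX c m i : lmon c m ^+ i = lmon (c ^+ i) (m *+ i).
Proof.
elim: i => [|i IH]; first by rewrite mulr0n !expr0 lmon1.
by rewrite exprS IH lmonM -exprS -mulrS.
Qed.

(** Monomials generate the Laurent polynomials additively, so biadditive identities such as the
    Leibniz rule need checking on monomials only. *)
Lemma lmon_ext (S : zmodType) (f g : laurent n R -> S) :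
  {morph f : a b / a + b} -> {morph g : a b / a + b} ->
  (forall c m, f (lmon c m) = g (lmon c m)) -> f =1 g.
Proof.
move=> fD gD fg F.
have D0 (h : laurent n R -> S) : {morph h : a b / a + b} -> h 0 = 0.
  by move=> hD; apply: (addrI (h 0)); rewrite -hD !addr0.
rewrite (lmonE F) (big_morph f fD (D0 _ fD)) (big_morph g gD (D0 _ gD)).
by apply: eq_bigr.
Qed.

End LaurentBasics.

(** * Substitution of powers of the variables, with a twist of the coefficients *)

Section LaurentMap.
Variables (n : nat) (R S : nzRingType) (f : {rmorphism R -> S}) (q : nat).

(** For [q] a power of [p] this is a Frobenius lift. Taking for [f] the same substitution in the
    variables of the coefficient ring twists [t] and [z] simultaneously. *)
Definition lmap (F : laurent n R) : laurent n S :=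
  \sum_(m <- msupp F) lmon (f F@_m) (m *+ q).

Lemma lmapw (d : {fset 'rV[int]_n}) F : (msupp F `<=` d)%fset ->
  lmap F = \sum_(m <- d) lmon (f F@_m) (m *+ q).
Proof.
move=> le; rewrite /lmap (big_fset_incl _ le) //= => k _ /mcoeff_outdom ->.
by rewrite rmorph0 lmon0.
Qed.

Lemma lmap_is_additive : additive lmap.
Proof.
move=> F G; rewrite (lmapw (msuppB_le F G)).
rewrite (lmapw (fsubsetUl (msupp F) (msupp G))).
rewrite (lmapw (fsubsetUr (msupp F) (msupp G))) -sumrB.
by apply: eq_bigr => m _; rewrite coefB rmorphB !lmon_def; exact: monalgUB.
Qed.

HB.instance Definition _ :=
  GRing.isAdditive.Build (laurent n R) (laurent n S) lmap lmap_is_additive.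

Lemma lmap_mon c m : lmap (lmon c m) = lmon (f c) (m *+ q).
Proof.
have le : (msupp (lmon c m) `<=` [fset m])%fset by rewrite lmon_def msuppU_le.
by rewrite (lmapw le) big_seq_fset1 coef_lmon eqxx.
Qed.

Lemma lmap_is_multiplicative : multiplicative lmap.
Proof.
split; last by rewrite -!lmon1 lmap_mon rmorph1 mul0rn.
have monM a i b j : lmap (lmon a i * lmon b j) = lmap (lmon a i) * lmap (lmon b j).
  rewrite (lmonM a b i j) !lmap_mon (lmonM (f a) (f b)).
  by rewrite mulrnDl (rmorphM f a b).
move=> F G; rewrite (lmonE F) mulr_suml !raddf_sum mulr_suml.
apply: eq_bigr => i _; rewrite (lmonE G) mulr_sumr !raddf_sum mulr_sumr.
by apply: eq_bigr => j _; exact: monM.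
Qed.

HB.instance Definition _ :=
  GRing.isMultiplicative.Build (laurent n R) (laurent n S) lmap
    lmap_is_multiplicative.

Lemma coef_lmap F m : (0 < q)%N -> (lmap F)@_(m *+ q) = f F@_m.
Proof.
move=> q0; rewrite /lmap coef_sum.
have inj (k : 'rV[int]_n) : (k *+ q == m *+ q) = (k == m).
  apply/eqP/eqP => [/rowP kq|->//]; apply/rowP => i; apply/eqP.
  by move/eqP: (kq i); rewrite !mulmxnE eqrMn2r eqn0Ngt q0.
case: (msuppP F m) => [mF|out].
  rewrite (bigD1_seq m) //= ?fset_uniq // coef_lmon eqxx mulr1n.
  rewrite big1 ?addr0 // => x xm.
  by rewrite coef_lmon inj (negPf xm).
rewrite rmorph0 big_seq big1 // => x xF; rewrite coef_lmon inj.
by case: eqP => // xm; move: xF; rewrite xm (negPf out).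
Qed.

Lemma msupp_lmap F m : m \in msupp (lmap F) -> exists2 k, k \in msupp F & m = k *+ q.
Proof.
rewrite -mcoeff_neq0 /lmap coef_sum => nz; apply/not_exists2P => all.
case/negP: nz; rewrite big_seq big1 // => k kF.
case: (all k) => // km; rewrite coef_lmon.
by case: eqP => // e; case: km.
Qed.

End LaurentMap.

(** * Divisibility by powers of p *)

Section PDivisibility.
Variables (K : comNzRingType) (p : nat).
Implicit Types (x y : K) (k : nat).

Definition pdvd k x := exists c, x = p%:R ^+ k * c.

Lemma pdvdk0 x : pdvd 0 x.
Proof. by exists x; rewrite expr0 mul1r. Qed.

Lemma pdvd0 k : pdvd k 0.
Proof. by exists 0; rewrite mulr0. Qed.

Lemma pdvdD k x y : pdvd k x -> pdvd k y -> pdvd k (x + y).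
Proof. by move=> [a ->] [b ->]; exists (a + b); rewrite mulrDr. Qed.

Lemma pdvdN k x : pdvd k x -> pdvd k (- x).
Proof. by move=> [a ->]; exists (- a); rewrite mulrN. Qed.

Lemma pdvdB k x y : pdvd k x -> pdvd k y -> pdvd k (x - y).
Proof. by move=> xk /pdvdN; apply: pdvdD. Qed.

Lemma pdvdM a b x y : pdvd a x -> pdvd b y -> pdvd (a + b) (x * y).
Proof. by move=> [c ->] [d ->]; exists (c * d); rewrite exprD mulrACA. Qed.

Lemma pdvdMl k x y : pdvd k y -> pdvd k (x * y).
Proof. exact: (pdvdM (pdvdk0 x)). Qed.

Lemma pdvdMr k x y : pdvd k x -> pdvd k (x * y).
Proof. by rewrite mulrC; apply: pdvdMl. Qed.

Lemma pdvd_leq a b x : (a <= b)%N -> pdvd b x -> pdvd a x.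
Proof. by move=> /subnKC<- [c ->]; exists (p%:R ^+ (b - a) * c); rewrite exprD mulrA. Qed.

Lemma pdvd_expp k : pdvd k (p%:R ^+ k : K).
Proof. by exists 1; rewrite mulr1. Qed.

Lemma pdvd_sum I (s : seq I) (P : pred I) (E : I -> K) k :
  (forall i, P i -> pdvd k (E i)) -> pdvd k (\sum_(i <- s | P i) E i).
Proof.
by move=> all; elim/big_rec: _ => [|i x Pi xk]; [exact: pdvd0|exact: pdvdD (all i Pi) xk].
Qed.

Lemma pdvd_trans k x y z : pdvd k (x - y) -> pdvd k (y - z) -> pdvd k (x - z).
Proof. by move=> xy yz; rewrite -(subrKA y); apply: pdvdD. Qed.

Lemma pdvd_congr k x y : pdvd k (x - y) -> pdvd k x -> pdvd k y.
Proof. by move=> xy xk; rewrite -(subKr x y); apply: pdvdB. Qed.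

Lemma pdvdBM k x x' y y' :
  pdvd k (x - x') -> pdvd k (y - y') -> pdvd k (x * y - x' * y').
Proof.
move=> xk yk; have -> : x * y - x' * y' = (x - x') * y + x' * (y - y').
  by ring.
by apply: pdvdD; [exact: pdvdMr|exact: pdvdMl].
Qed.

Lemma pdvdBX k x y i : pdvd k (x - y) -> pdvd k (x ^+ i - y ^+ i).
Proof. by rewrite subrXX; apply: pdvdMr. Qed.

(** The cofactor of [x - y] is a sum of [p] terms, all congruent to [y ^+ p.-1] modulo [p], hence it
    supplies one more factor [p]. *)
Lemma pdvd_exprp k x y : pdvd k.+1 (x - y) -> pdvd k.+2 (x ^+ p - y ^+ p).
Proof.
move=> xy; rewrite subrXX -addn1; apply: pdvdM => //.
have -> : \sum_(i < p) x ^+ (p.-1 - i) * y ^+ i =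
    \sum_(i < p) (x ^+ (p.-1 - i) * y ^+ i - y ^+ (p.-1 - i) * y ^+ i) +
    \sum_(i < p) y ^+ p.-1.
  rewrite -big_split; apply: eq_bigr => i _ /=.
  rewrite -[in X in _ + X](@subnK i p.-1) ?exprD ?subrK // -ltnS prednK //.
  exact: leq_ltn_trans (ltn_ord i).
apply: pdvdD; last first.
  by rewrite sumr_const card_ord -mulr_natl; apply: pdvdMr; exact: (pdvd_expp 1).
apply: pdvd_sum => i _; rewrite -mulrBl; apply: pdvdMr; apply: pdvdBX.
exact: pdvd_leq xy.
Qed.

Lemma pdvd_exprpX b x y :
  pdvd 1 (x - y) -> pdvd b.+1 (x ^+ (p ^ b) - y ^+ (p ^ b)).
Proof.
move=> xy; elim: b => [|b IH]; first by rewrite expn0 !expr1.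
by rewrite expnSr !exprM; apply: pdvd_exprp.
Qed.

(** Induction on [k]: primality extracts one factor [p] from [y], and it can be cancelled because
    [p] is not a zero divisor. *)
Lemma pdvd_prime_regular :
  (forall x, p%:R * x = 0 -> x = 0) ->
  (forall x y, pdvd 1 (x * y) -> pdvd 1 x \/ pdvd 1 y) ->
  forall x, ~ pdvd 1 x -> forall k y, pdvd k (x * y) -> pdvd k y.
Proof.
move=> mulp_eq0 prime_p x nx; elim=> [|k IH] y xy; first exact: pdvdk0.
have [/nx//|[z yz]] := prime_p _ _ (pdvd_leq (ltn0Sn k) xy).
rewrite expr1 in yz; have [w xyw] := xy.
rewrite yz -add1n; apply: pdvdM; first exact: (pdvd_expp 1).
apply: IH; exists w; apply/eqP; rewrite -subr_eq0; apply/eqP; apply: mulp_eq0.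
by rewrite mulrBr mulrCA -yz xyw mulrA exprS subrr.
Qed.

Hypothesis p_prime : prime p.

Lemma pdvd_freshmanD x y : pdvd 1 ((x + y) ^+ p - (x ^+ p + y ^+ p)).
Proof.
have p0 := prime_gt0 p_prime.
rewrite exprDn (bigD1 ord0) //= (bigD1 ord_max) //=; last first.
  by rewrite -val_eqE /= -lt0n.
rewrite subn0 subnn bin0 binn !expr0 mulr1 mul1r !mulr1n addrA [X in pdvd _ X]addrC addKr.
apply: pdvd_sum => i /andP[]; rewrite -!val_eqE /= => i0 ip.
have /dvdnP[c ->] : (p %| 'C(p, i))%N.
  by apply: prime_dvd_bin => //; rewrite lt0n i0 ltn_neqAle ip -ltnS ltn_ord.
by exists ((x ^+ (p - i) * y ^+ i) *+ c); rewrite expr1 mulr_natl -mulrnA.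
Qed.

Lemma pdvd_freshman I (s : seq I) (E : I -> K) :
  pdvd 1 ((\sum_(i <- s) E i) ^+ p - \sum_(i <- s) E i ^+ p).
Proof.
elim: s => [|i s IH].
  rewrite !big_nil expr0n -[p]prednK ?prime_gt0 // subrr; exact: pdvd0.
rewrite !big_cons; apply: pdvd_trans (pdvd_freshmanD _ _) _.
by rewrite opprD addrACA subrr add0r.
Qed.

End PDivisibility.

Lemma pdvd_rmorph (K L : comNzRingType) (f : {rmorphism K -> L}) p k x :
  pdvd p k x -> pdvd p k (f x).
Proof. by move=> [c ->]; exists (f c); rewrite rmorphM rmorphXn rmorph_nat. Qed.

Lemma pdvd_laurent n (R : comNzRingType) p k (F : laurent n R) :
  pdvd p k F <-> forall m, pdvd p k F@_m.
Proof.
have coefZ G m : ((p%:R ^+ k : laurent n R) * G)@_m = p%:R ^+ k * G@_m.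
  by rewrite -!natrX !mulr_natl coefMn.
split=> [[G ->] m|all]; first by exists G@_m; rewrite coefZ.
have [c cP] := choice all.
exists (\sum_(m <- msupp F) lmon (c m) m); rewrite mulr_sumr [LHS]lmonE.
apply: eq_bigr => m _; apply: laurentP => j.
by rewrite (coefZ (lmon (c m) m) j) !coef_lmon cP mulrnAr.
Qed.


Lemma pdvd_lmon n (R : comNzRingType) p k (c : R) (m : 'rV[int]_n) :
  pdvd p k c -> pdvd p k (lmon c m).
Proof.
by move=> ck; apply/pdvd_laurent => j; rewrite coef_lmon -mulr_natl; apply: pdvdMl.
Qed.

Lemma lmap_comp n (R S T : nzRingType) (g : {rmorphism R -> S})
    (f : {rmorphism S -> T}) (h : {rmorphism R -> T}) q q' (F : laurent n R) :
  (forall x, f (g x) = h x) -> lmap f q (lmap g q' F) = lmap h (q' * q) F.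
Proof.
move=> fg; rewrite (lmonE F) (raddf_sum (lmap g q')) (raddf_sum (lmap f q)).
rewrite (raddf_sum (lmap h _)); apply: eq_bigr => m _.
by rewrite /= !lmap_mon fg mulrnA.
Qed.

(** The freshman's dream reduces the claim to monomials, where it is the hypothesis on the
    coefficients. It is applied first over the p-adic integers, then over the Laurent polynomials in
    [z]. *)
Lemma lmap_frobenius n (R : comNzRingType) (f : {rmorphism R -> R}) p
    (F : laurent n R) : prime p ->
  (forall x : R, pdvd p 1 (x ^+ p - f x)) -> pdvd p 1 (F ^+ p - lmap f p F).
Proof.
move=> p_prime fP; rewrite {1}(lmonE F).
apply: (pdvd_trans (pdvd_freshman p_prime _ _)); rewrite /lmap -sumrB.
apply: pdvd_sum => m _; rewrite lmonX.
have <- : lmon (F@_m ^+ p - f F@_m) (m *+ p) =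
    lmon (F@_m ^+ p) (m *+ p) - lmon (f F@_m) (m *+ p).
  by apply: (addIr (lmon (f F@_m) (m *+ p))); rewrite -lmonD !subrK.
exact: pdvd_lmon.
Qed.

(** * Arithmetic of p-adic integers *)

Section PadicArithmetic.
Variable p : nat.
Hypothesis p_prime : prime p.
Local Notation Zp := (padic_int p).
Implicit Types a b : Zp.

Let exp_gt1 n : (1 < p ^ n.+1)%N.
Proof. by rewrite -(expn0 p) ltn_exp2l // prime_gt1. Qed.

Lemma padic_valM a b n : padic_val (a * b) n = padic_val a n * padic_val b n.
Proof. by []. Qed.

Lemma padic_val_nat i n : padic_val (i%:R : Zp) n = i%:R.
Proof. by elim: i => // i IH; rewrite -!natr1 -IH. Qed.

Lemma padic_valX a i n : padic_val (a ^+ i) n = padic_val a n ^+ i.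
Proof. by elim: i => // i IH; rewrite !exprS -IH. Qed.

Lemma Zp_natr_eq0 n (i : nat) : ((i%:R : 'Z_(p ^ n.+1)) == 0) = (p ^ n.+1 %| i)%N.
Proof. by rewrite -val_eqE /= val_Zp_nat. Qed.

Lemma padic_val_mod a n : padic_val a n.+1 = padic_val a n %[mod p ^ n.+1].
Proof.
have := congr1 val (padic_compat a n); rewrite /= val_Zp_nat // => ->.
by rewrite modn_mod.
Qed.

(** Cancelling [p] costs one digit: component [n] of [a] is read off component [n.+1] of the
    product. *)
Lemma padic_mulp_eq0 a : p%:R * a = 0 -> a = 0.
Proof.
move=> pa; apply: padicP => n; rewrite padic_compat.
have : padic_val (p%:R * a) n.+1 = 0 by rewrite pa.
rewrite padic_valM padic_val_nat.
rewrite -{1}[padic_val a n.+1]natr_Zp -natrM => /eqP.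
rewrite Zp_natr_eq0; move: (nat_of_ord _) => i.
rewrite expnS dvdn_pmul2l ?prime_gt0 // => dvd.
by apply/eqP; rewrite Zp_natr_eq0.
Qed.

Lemma pdvd1_padicE a : pdvd p 1 a <-> padic_val a 0 = 0.
Proof.
split=> [[c ->]|a0].
  rewrite expr1 padic_valM padic_val_nat; have /eqP-> : (p%:R : 'Z_(p ^ 1)) == 0.
    by rewrite Zp_natr_eq0 expn1.
  by rewrite mul0r.
have dvdp n : (p %| padic_val a n)%N.
  elim: n => [|n IH]; first by rewrite a0.
  have := padic_val_mod a n => /(congr1 (modn^~ p)).
  by rewrite !modn_dvdm ?dvdn_exp // => /eqP; rewrite (eqP IH) => /eqP/eqP.
(* The quotient of a residue modulo [p ^ n.+2] by [p] is known modulo [p ^ n.+1] only, hence the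
   shift of index. *)
pose c n : 'Z_(p ^ n.+1) := (padic_val a n.+1 %/ p)%N%:R.
have cP n : c n = (c n.+1 : nat)%:R.
  rewrite /c Zp_red_subproof; apply/val_inj; rewrite /= !val_Zp_nat //.
  apply/eqP; rewrite -(eqn_pmul2r (prime_gt0 p_prime)) !muln_modl -expnSr.
  by rewrite !divnK // eq_sym; apply/eqP; exact: padic_val_mod.
exists (PadicInt cP); apply: padicP => n.
rewrite expr1 padic_valM padic_val_nat /= /c -natrM mulnC divnK //.
exact: padic_compat.
Qed.

Lemma padic_fermat a : pdvd p 1 (a ^+ p - a).
Proof.
apply/pdvd1_padicE.
rewrite -[LHS]/(padic_val (a ^+ p) 0 - padic_val a 0) padic_valX.
rewrite -[padic_val a 0]natr_Zp -natrX.
apply/eqP; rewrite subr_eq0; apply/eqP/val_inj.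
rewrite /= !val_Zp_nat //; move: (nat_of_ord _) => i.
by rewrite expn1; exact: fermat_little.
Qed.

Lemma pdvd1_padicM a b : pdvd p 1 (a * b) -> pdvd p 1 a \/ pdvd p 1 b.
Proof.
rewrite !pdvd1_padicE padic_valM -[padic_val a 0]natr_Zp -[padic_val b 0]natr_Zp.
move: (nat_of_ord (padic_val a 0)) (nat_of_ord (padic_val b 0)) => i j.
rewrite -natrM => /eqP; rewrite Zp_natr_eq0 Euclid_dvdM // => /orP[] dvd.
  by left; apply/eqP; rewrite Zp_natr_eq0.
by right; apply/eqP; rewrite Zp_natr_eq0.
Qed.

End PadicArithmetic.

(** * Laurent polynomials modulo p *)

Lemma eq_addz_le (a b c d : int) :
  a + b = c + d -> a <= c -> b <= d -> (a == c) /\ (b == d).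
Proof.
move=> e ac bd; rewrite !eq_le ac bd /=.
by rewrite -(lerD2r b) e lerD2l bd -(lerD2l a) e lerD2r ac.
Qed.

Lemma seq_argmax (T : eqType) (f : T -> int) (s : seq T) x0 : x0 \in s ->
  exists2 x, x \in s & {in s, forall y, f y <= f x}.
Proof.
elim: s x0 => // a [|b s] IH x0 _.
  by exists a; rewrite ?mem_head // => y; rewrite inE => /eqP->.
have [|x xs xmax] := IH b; first exact: mem_head.
have [ax|/ltW xa] := lerP (f a) (f x).
  exists x; first by rewrite inE xs orbT.
  by move=> y; rewrite inE => /predU1P[->//|]; exact: xmax.
exists a; first exact: mem_head.
by move=> y; rewrite inE => /predU1P[->//|/xmax yx]; exact: le_trans xa.
Qed.

(* The lexicographically maximal points of two finite subsets of Z^n, obtained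
   by maximizing one coordinate after the other, have a sum which is attained
   only once. *)
Lemma unique_sum n (X Y : seq 'rV[int]_n) x0 y0 : x0 \in X -> y0 \in Y ->
  exists a b, [/\ a \in X, b \in Y &
    forall x y, x \in X -> y \in Y -> x + y = a + b -> x = a /\ y = b].
Proof.
move=> x0X y0Y.
(* After [d] rounds the first [d] coordinates are constant on [X'] and on [Y'], and a sum of points
   of [X'] and [Y'] has no other decomposition over [X] and [Y] than inside [X'] and [Y']. *)
suff /(_ n (leqnn n))[X' [Y' [a [b [[[subX aX] [subY bY] sumP] cstX cstY]]]]] :
  forall d, (d <= n)%N -> exists (X' Y' : seq 'rV[int]_n) (a b : 'rV[int]_n),
    [/\ [/\ {subset X' <= X} /\ a \in X', {subset Y' <= Y} /\ b \in Y' &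
        forall x y x' y', x \in X -> y \in Y -> x' \in X' -> y' \in Y' ->
          x + y = x' + y' -> x \in X' /\ y \in Y'],
        forall x (i : 'I_n), x \in X' -> (i < d)%N -> x 0 i = a 0 i &
        forall y (i : 'I_n), y \in Y' -> (i < d)%N -> y 0 i = b 0 i].
  exists a, b; split=> [||x y xX yY xy]; [exact: subX|exact: subY|].
  have [xX' yY'] := sumP _ _ _ _ xX yY aX bY xy.
  by split; apply/rowP => i; [exact: cstX|exact: cstY].
elim=> [_|d IH dn].
  exists X, Y, x0, y0; split; try by move=> z i _; rewrite ltn0.
  by split; [split|split|].
have [X' [Y' [a0 [b0 [[[subX aX] [subY bY] sumP] cstX cstY]]]]] := IH (ltnW dn).
pose k := Ordinal dn.
have [a aX' amax] := seq_argmax (fun x : 'rV[int]_n => x 0 k) aX.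
have [b bY' bmax] := seq_argmax (fun y : 'rV[int]_n => y 0 k) bY.
exists [seq x : 'rV[int]_n <- X' | x 0 k == a 0 k].
exists [seq y : 'rV[int]_n <- Y' | y 0 k == b 0 k], a, b.
split; first split.
- by split; [move=> x; rewrite mem_filter => /andP[_ /subX]|rewrite mem_filter eqxx].
- by split; [move=> x; rewrite mem_filter => /andP[_ /subY]|rewrite mem_filter eqxx].
- move=> x y x' y' xX yY; rewrite !mem_filter.
  move=> /andP[/eqP x'k x'X] /andP[/eqP y'k y'Y] xy.
  have [xX' yY'] := sumP _ _ _ _ xX yY x'X y'Y xy; rewrite xX' yY' !andbT.
  have := congr1 (fun z : 'rV[int]_n => z 0 k) xy; rewrite !mxE x'k y'k.
  by move/eq_addz_le; apply; [exact: amax|exact: bmax].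
- move=> x i; rewrite mem_filter ltnS leq_eqVlt => /andP[/eqP xk xX'].
  case/predU1P=> [ik|id]; first by rewrite (_ : i = k) //; apply/val_inj.
  by rewrite (cstX x) // (cstX a) ?aX'.
- move=> y i; rewrite mem_filter ltnS leq_eqVlt => /andP[/eqP yk yY'].
  case/predU1P=> [ik|id]; first by rewrite (_ : i = k) //; apply/val_inj.
  by rewrite (cstY y) // (cstY b) ?bY'.
Qed.

Section PrimeElement.
Variables (n : nat) (R : comNzRingType) (p : nat).
Hypothesis R_mulp : forall x : R, p%:R * x = 0 -> x = 0.
Hypothesis R_primep : forall x y : R,
  pdvd p 1 (x * y) -> pdvd p 1 x \/ pdvd p 1 y.
Implicit Types F G : laurent n R.

Lemma laurent_mulp_eq0 F : p%:R * F = 0 -> F = 0.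
Proof.
move=> pF; apply: laurentP => m; rewrite coef0; apply: R_mulp.
by rewrite mulr_natl -coefMn -mulr_natl pF coef0.
Qed.

(** Among the exponents whose coefficients are nonzero modulo [p], [unique_sum] gives [a + b]
    attained only once. The coefficient of [F * G] there is congruent to [F@_a * G@_b] modulo [p],
    since any other term has a factor divisible by [p]. *)
Lemma pdvd1_laurentM F G : pdvd p 1 (F * G) -> pdvd p 1 F \/ pdvd p 1 G.
Proof.
move=> FG; apply: contrapT => /not_orP[nF nG].
have ex (H : laurent n R) : ~ pdvd p 1 H -> exists m, ~ pdvd p 1 H@_m.
  by move=> nH; apply/existsNP => all; apply: nH; apply/pdvd_laurent.
pose S (H : laurent n R) := [seq m <- msupp H | ~~ `[< pdvd p 1 H@_m >]].
have SP (H : laurent n R) m : ~ pdvd p 1 H@_m -> m \in S H.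
  move=> nm; rewrite mem_filter; apply/andP; split; first by apply/asboolPn.
  by case: msuppP nm => // _ []; exact: pdvd0.
have [f0 /SP f0S] := ex F nF; have [g0 /SP g0S] := ex G nG.
have [a [b [aS bS uab]]] := unique_sum f0S g0S.
move: (aS) (bS); rewrite !mem_filter => /andP[/asboolPn nFa aF] /andP[/asboolPn nGb _].
suff : pdvd p 1 (F@_a * G@_b) by case/R_primep.
move/pdvd_laurent/(_ (a + b)): FG.
rewrite coefM (bigD1_seq a) //= ?fset_uniq // [a + b - a]addrC addKr.
set s := (X in _ + X) => Fs; rewrite -[_ * _](addrK s); apply: pdvdB => //.
apply: pdvd_sum => k ka.
have [|nFk] := pselect (pdvd p 1 F@_k); first exact: pdvdMr.
have [|nGk] := pselect (pdvd p 1 G@_(a + b - k)); first exact: pdvdMl.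
have [|ak _] := uab _ _ (SP _ _ nFk) (SP _ _ nGk); first by rewrite addrC subrK.
by case/eqP: ka.
Qed.

Lemma pdvd_laurent_regular F : ~ pdvd p 1 F ->
  forall k G, pdvd p k (F * G) -> pdvd p k G.
Proof.
exact: (pdvd_prime_regular (@laurent_mulp_eq0) (@pdvd1_laurentM)).
Qed.

End PrimeElement.

(** * Congruences between matrix quotients *)

Section MatrixCongruences.
Variables (K : comNzRingType) (p g : nat).
Implicit Types (A B F H X Y : 'M[K]_g) (c : K).

Definition mxdvd k X := forall i j, pdvd p k (X i j).

Lemma mxdvd0 k : mxdvd k 0.
Proof. by move=> i j; rewrite mxE; apply: pdvd0. Qed.

Lemma mxdvdk0 X : mxdvd 0 X.
Proof. by move=> i j; apply: pdvdk0. Qed.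

Lemma mxdvdD k X Y : mxdvd k X -> mxdvd k Y -> mxdvd k (X + Y).
Proof. by move=> Xk Yk i j; rewrite mxE; apply: pdvdD. Qed.

Lemma mxdvdN k X : mxdvd k X -> mxdvd k (- X).
Proof. by move=> Xk i j; rewrite mxE; apply: pdvdN. Qed.

Lemma mxdvd_leq a b X : (a <= b)%N -> mxdvd b X -> mxdvd a X.
Proof. by move=> ab Xb i j; apply: pdvd_leq (Xb i j). Qed.

Lemma mxdvdZ a b c X : pdvd p a c -> mxdvd b X -> mxdvd (a + b) (c *: X).
Proof. by move=> ca Xb i j; rewrite mxE; apply: pdvdM. Qed.

Lemma mxdvdM a b X Y : mxdvd a X -> mxdvd b Y -> mxdvd (a + b) (X *m Y).
Proof. by move=> Xa Yb i j; rewrite mxE; apply: pdvd_sum => k _; apply: pdvdM. Qed.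

Lemma mxdvdMl k X Y : mxdvd k Y -> mxdvd k (X *m Y).
Proof. exact: (mxdvdM (mxdvdk0 X)). Qed.

Lemma mxdvdMr k X Y : mxdvd k X -> mxdvd k (X *m Y).
Proof. by move=> Xk; rewrite -[k]addn0; apply: mxdvdM (mxdvdk0 Y). Qed.

Definition pregular c := forall k x, pdvd p k (c * x) -> pdvd p k x.

Lemma pregularM c d : pregular c -> pregular d -> pregular (c * d).
Proof. by move=> cr dr k x; rewrite -mulrA => /cr/dr. Qed.

Lemma mxdvd_regular k c X : pregular c -> mxdvd k (c *: X) -> mxdvd k X.
Proof. by move=> cr Xk i j; apply: cr; have := Xk i j; rewrite mxE. Qed.

(* [F *m invmx A = F' *m invmx A'] modulo p^k, with denominators cleared. *)
Definition fraccong k F A F' A' :=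
  mxdvd k (\det A' *: (F *m \adj A) - \det A *: (F' *m \adj A')).

Lemma fraccong0 F A F' A' : fraccong 0 F A F' A'.
Proof. exact: mxdvdk0. Qed.

Lemma fraccong_refl k A A' : fraccong k A A A' A'.
Proof.
rewrite /fraccong !mul_mx_adj !scale_scalar_mx mulrC subrr; exact: mxdvd0.
Qed.

Lemma fraccong_leq a b F A F' A' : (a <= b)%N ->
  fraccong b F A F' A' -> fraccong a F A F' A'.
Proof. exact: mxdvd_leq. Qed.

Lemma fraccongD k F H F' H' A A' : fraccong k F A F' A' ->
  fraccong k H A H' A' -> fraccong k (F + H) A (F' + H') A'.
Proof.
rewrite /fraccong !mulmxDl !scalerDr opprD addrACA; exact: mxdvdD.
Qed.

Lemma fraccong_sum k (s : seq nat) (F F' : nat -> 'M[K]_g) A A' :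
  (forall i, i \in s -> fraccong k (F i) A (F' i) A') ->
  fraccong k (\sum_(i <- s) F i) A (\sum_(i <- s) F' i) A'.
Proof.
elim: s => [|i s IH] FF'.
  by rewrite !big_nil /fraccong !mul0mx !scaler0 subrr; apply: mxdvd0.
rewrite !big_cons; apply: fraccongD; first by apply: FF'; rewrite mem_head.
by apply: IH => j js; apply: FF'; rewrite inE js orbT.
Qed.

Lemma fraccongMl a b B F A F' A' : mxdvd a B ->
  fraccong b F A F' A' -> fraccong (a + b) (B *m F) A (B *m F') A'.
Proof.
by rewrite /fraccong -!mulmxA !scalemxAr -mulmxBr; exact: mxdvdM.
Qed.

Lemma fraccongZ a b c F A F' A' : pdvd p a c ->
  fraccong b F A F' A' -> fraccong (a + b) (c *: F) A (c *: F') A'.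
Proof.
move=> ca FF'; rewrite /fraccong -!scalemxAl !scalerA ![_ * c]mulrC -!scalerA.
by rewrite -scalerBr; apply: mxdvdZ.
Qed.

Lemma fraccong_dvd k F A A' : mxdvd k F -> fraccong k F A 0 A'.
Proof.
move=> Fk; rewrite /fraccong mul0mx scaler0 subr0.
by apply: (mxdvdZ (pdvdk0 _ _)); apply: mxdvdMr.
Qed.

Lemma mulmx_adj_cancel H F A :
  (H *m \adj F) *m (F *m A) = \det F *: (H *m A).
Proof. by rewrite mulmxA -(mulmxA H) mul_adj_mx mul_mx_scalar -scalemxAl. Qed.

(** Multiplies quotients: with [a = H F^-1] and [b = F A^-1], [ab - a'b' = (a - a')b' + a(b - b')].
    The determinants of the middle matrices [F] and [F'] are then cancelled. *)
Lemma fraccong_trans k H F A H' F' A' :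
  pregular (\det F) -> pregular (\det F') ->
  fraccong k H F H' F' -> fraccong k F A F' A' -> fraccong k H A H' A'.
Proof.
move=> Fr Fr' HF FA; apply: (mxdvd_regular (pregularM Fr Fr')).
have := mxdvdD (mxdvdMr (\det A *: (F' *m \adj A')) HF)
  (mxdvdMl (\det F' *: (H *m \adj F)) FA).
set X := _ + _; set Y := _ *: _; suff -> : X = Y by [].
rewrite {}/X {}/Y mulmxBl mulmxBr addrC subrKA.
rewrite -!scalemxAl -!scalemxAr !mulmx_adj_cancel !scalerBr !scalerA.
by congr (_ *: _ - _ *: _); ring.
Qed.

(** With [q = F A^-1], the identity is [q^-1 - q'^-1 = - q^-1 (q - q') q'^-1]; clearing denominators
    leaves the factor [\det A * \det A'], which is cancelled. *)
Lemma fraccong_inv k F A F' A' : pregular (\det A) -> pregular (\det A') ->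
  fraccong k F A F' A' -> fraccong k A F A' F'.
Proof.
move=> Ar Ar' FA; apply: (mxdvd_regular (pregularM Ar Ar')).
have := mxdvdN (mxdvdMr (A' *m \adj F') (mxdvdMl (A *m \adj F) FA)).
set X := - _; set Y := _ *: _; suff -> : X = Y by [].
rewrite {}/X {}/Y mulmxBr mulmxBl opprB -!scalemxAr -!scalemxAl mulmx_adj_cancel.
rewrite -mulmxA mulmx_adj_cancel !mul_mx_adj -!scalemxAl -scalemxAr.
rewrite mul_mx_scalar mul_scalar_mx !scalerBr !scalerA.
by congr (_ *: _ - _ *: _); ring.
Qed.

End MatrixCongruences.

(** * Derivations applied to matrices *)

Definition derivation (K : comNzRingType) (D : K -> K) :=
  {morph D : x y / x + y} /\ forall x y, D (x * y) = D x * y + x * D y.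

Section Derivations.
Variables (K : comNzRingType) (p g : nat) (D : K -> K).
Hypothesis derD : derivation D.
Implicit Types X Y : 'M[K]_g.

Lemma derivation0 : D 0 = 0.
Proof. by have [DD _] := derD; apply: (addrI (D 0)); rewrite -DD !addr0. Qed.

Lemma derivation_nat k x : D (k%:R * x) = k%:R * D x.
Proof.
rewrite !mulr_natl; elim: k => [|k IH]; first by rewrite !mulr0n derivation0.
by rewrite !mulrS (proj1 derD) IH.
Qed.

Lemma pdvd_derivation k x : pdvd p k x -> pdvd p k (D x).
Proof. by move=> [c ->]; exists (D c); rewrite -natrX derivation_nat. Qed.

Lemma mxdvd_derivation k X : mxdvd p k X -> mxdvd p k (map_mx D X).
Proof. by move=> Xk i j; rewrite mxE; apply: pdvd_derivation. Qed.

Lemma map_derivationD X Y : map_mx D (X + Y) = map_mx D X + map_mx D Y.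
Proof. by apply/matrixP => i j; rewrite !mxE (proj1 derD). Qed.

Lemma map_derivation_sum (s : seq nat) (X : nat -> 'M[K]_g) :
  map_mx D (\sum_(i <- s) X i) = \sum_(i <- s) map_mx D (X i).
Proof.
elim: s => [|i s IH]; last by rewrite !big_cons map_derivationD IH.
by rewrite !big_nil; apply/matrixP => i j; rewrite !mxE derivation0.
Qed.

Lemma map_derivationM X Y :
  map_mx D (X *m Y) = map_mx D X *m Y + X *m map_mx D Y.
Proof.
apply/matrixP => i j; rewrite !mxE -big_split /= (big_morph D (proj1 derD) derivation0).
by apply: eq_bigr => k _; rewrite (proj2 derD) !mxE.
Qed.

Lemma map_derivationZ c X :
  map_mx D (c *: X) = D c *: X + c *: map_mx D X.
Proof. by apply/matrixP => i j; rewrite !mxE (proj2 derD). Qed.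

End Derivations.

(** * Dwork congruences for abstract families of matrices *)

Section DworkCongruences.
Variables (K : comNzRingType) (p g l : nat).
(** [phi a] abstracts the Frobenius twist by [p ^ a], [E] the partial sums of the exponents, and
    [A i j] the Hasse-Witt matrix of the factors of index [i] to [j.-1]. *)
Variables (phi : nat -> {rmorphism K -> K}) (E : nat -> nat -> nat).
Variable (A : nat -> nat -> 'M[K]_g).

Hypothesis phi_comp : forall a b x, phi a (phi b x) = phi (a + b)%N x.
Hypothesis E_add : forall i m j, (i <= m <= j)%N -> (E i m + E m j)%N = E i j.
Hypothesis E_gt0 : forall i j, (i < j <= l)%N -> (0 < E i j)%N.
Hypothesis A_regular : forall a i j, (i <= j <= l.+1)%N ->
  pregular p (\det (map_mx (phi a) (A i j))).
(* The coefficients [B m] are the same for [A i j] and [A i j.+1]. *)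
Hypothesis A_expand : forall i j, (i < j <= l)%N ->
  exists (B : nat -> 'M[K]_g) (C : 'M[K]_g),
  [/\ A i j = \sum_(i.+1 <= m < j.+1) B m *m map_mx (phi (E i m)) (A m j),
      A i j.+1 = \sum_(i.+1 <= m < j.+1) B m *m map_mx (phi (E i m)) (A m j.+1) + C,
      forall m, (i < m <= j)%N -> mxdvd p (m - i.+1) (B m) &
      mxdvd p (j - i) C].

Lemma map_phi_comp a b (X : 'M[K]_g) :
  map_mx (phi a) (map_mx (phi b) X) = map_mx (phi (a + b)%N) X.
Proof. by apply/matrixP => s t; rewrite !mxE phi_comp. Qed.

Lemma fraccong_phi a k (F G F' G' : 'M[K]_g) : fraccong p k F G F' G' ->
  fraccong p k (map_mx (phi a) F) (map_mx (phi a) G)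
               (map_mx (phi a) F') (map_mx (phi a) G').
Proof.
move=> FG; rewrite /fraccong !det_map_mx -!map_mx_adj -!map_mxM -!map_mxZ -map_mxB.
by move=> s t; rewrite mxE; apply: pdvd_rmorph.
Qed.

(** Induction on [j - i]. For [m = i.+1] the inverse quotient is treated: the expansion of [A i j]
    is divided by the twist of [A i.+1 j]. The other [m] follow by multiplying with the twisted
    congruence for [i.+1]. *)
Lemma frobenius_quotient i m j : (i < m <= j)%N -> (j <= l)%N ->
  fraccong p (j - m).+1 (map_mx (phi (E i m)) (A m j.+1)) (A i j.+1)
                        (map_mx (phi (E i m)) (A m j)) (A i j).
Proof.
move=> imj jl; have [n] := ubnP (j - i); elim: n i m imj => // n IH i m /andP[im mj] ijn.
have ij : (i < j)%N by exact: leq_trans mj.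
have base : fraccong p (j - i)
    (map_mx (phi (E i i.+1)) (A i.+1 j.+1)) (A i j.+1)
    (map_mx (phi (E i i.+1)) (A i.+1 j)) (A i j).
  have [|B [C [Aij Aij1 Bdvd Cdvd]]] := A_expand (i := i) (j := j).
    by rewrite ij jl.
  apply: fraccong_inv; [apply: A_regular; lia|apply: A_regular; lia|].
  (* The term [C] has no counterpart in the expansion of [A i j] and is matched with [0]. *)
  rewrite Aij Aij1 -[X in fraccong _ _ _ _ X]addr0.
  apply: fraccongD (fraccong_dvd _ _ Cdvd).
  apply: fraccong_sum => k; rewrite mem_index_iota => /andP[ik kj].
  (* [B k] accounts for [k - i.+1] factors [p], the quotient of twists for the other
     [(j - k).+1]. *)
  have -> : (j - i = (k - i.+1) + (j - k).+1)%N by lia.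
  apply: fraccongMl; first by apply: Bdvd; lia.
  have [->|ki1] := eqVneq k i.+1; first exact: fraccong_refl.
  have <- : (E i i.+1 + E i.+1 k = E i k)%N by apply: E_add; lia.
  by rewrite -!map_phi_comp; apply: fraccong_phi; apply: IH; lia.
have [->|mi1] := eqVneq m i.+1; first by apply: fraccong_leq base; lia.
have <- : (E i i.+1 + E i.+1 m = E i m)%N by apply: E_add; lia.
apply: (@fraccong_trans _ _ _ _ _ (map_mx (phi (E i i.+1)) (A i.+1 j.+1))
  _ _ (map_mx (phi (E i i.+1)) (A i.+1 j))).
- by apply: A_regular; lia.
- by apply: A_regular; lia.
- by rewrite -!map_phi_comp; apply: fraccong_phi; apply: IH; lia.
- by apply: fraccong_leq base; lia.
Qed.

Section OneDerivation.
Variables (D : K -> K).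
Hypothesis derD : derivation D.
Hypothesis D_phi : forall a, exists2 c, pdvd p a c &
  forall x, D (phi a x) = c * phi a (D x).

Lemma map_derivation_phi a : exists2 c, pdvd p a c & forall X : 'M[K]_g,
  map_mx D (map_mx (phi a) X) = c *: map_mx (phi a) (map_mx D X).
Proof.
have [c ca Dphi] := D_phi a; exists c => // X.
by apply/matrixP => s t; rewrite !mxE.
Qed.

(* Differentiating x^(p^a) gains a factor p^a, so one digit of precision can be
   lost on the derivative of the twisted factor. *)
Lemma fraccong_scaled_phi (c : K) (F F' : 'M[K]_g) i m j :
  (i < m <= j)%N -> (j <= l)%N -> pdvd p (E i m) c ->
  fraccong p (j - m) F (A m j.+1) F' (A m j) ->
  fraccong p (j - m).+1 (c *: map_mx (phi (E i m)) F) (A i j.+1)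
                        (c *: map_mx (phi (E i m)) F') (A i j).
Proof.
move=> imj jl ca FF'; rewrite -add1n; apply: fraccongZ.
  by apply: pdvd_leq ca; apply: E_gt0; lia.
apply: fraccong_trans (fraccong_phi _ FF') _; try (apply: A_regular; lia).
by apply: fraccong_leq (frobenius_quotient _ _) => //; lia.
Qed.

(** Each term of the expansion splits by the Leibniz rule. [D (B m)] is as divisible as [B m] and is
    paired with [frobenius_quotient]; the derivative of the twisted factor is handled by the
    induction hypothesis at [m]. *)
Lemma derivation_quotient i j : (i <= j <= l)%N ->
  fraccong p (j - i) (map_mx D (A i j.+1)) (A i j.+1) (map_mx D (A i j)) (A i j).
Proof.
move=> /andP[ij jl]; have [n] := ubnP (j - i); elim: n i ij => // n IH i ij ijn.
have [->|ij'] := eqVneq i j; first by rewrite subnn; apply: fraccong0.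
have [|B [C [Aij Aij1 Bdvd Cdvd]]] := A_expand (i := i) (j := j); first by lia.
rewrite {1}Aij {1}Aij1 (map_derivationD derD) !(map_derivation_sum derD).
rewrite -[X in fraccong _ _ _ _ X]addr0.
apply: fraccongD (fraccong_dvd _ _ (mxdvd_derivation derD Cdvd)).
apply: fraccong_sum => m; rewrite mem_index_iota => /andP[im mj].
have -> : (j - i = (m - i.+1) + (j - m).+1)%N by lia.
have Bm : mxdvd p (m - i.+1) (B m) by apply: Bdvd; lia.
rewrite !(map_derivationM derD); apply: fraccongD.
  apply: fraccongMl (mxdvd_derivation derD Bm) _.
  by apply: frobenius_quotient; lia.
apply: fraccongMl Bm _; have [c ca Dphi] := map_derivation_phi (E i m).
by rewrite !Dphi; apply: fraccong_scaled_phi => //; [lia|apply: IH; lia].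
Qed.

End OneDerivation.

Section TwoDerivations.
Variables (D1 D2 : K -> K).
Hypothesis (derD1 : derivation D1) (derD2 : derivation D2).
Hypothesis D1_phi : forall a, exists2 c, pdvd p a c &
  forall x, D1 (phi a x) = c * phi a (D1 x).
Hypothesis D2_phi : forall a, exists2 c, pdvd p a c &
  forall x, D2 (phi a x) = c * phi a (D2 x).

(** The same induction. The mixed terms, with one derivative on [B m] and one on the twisted factor,
    rely on [derivation_quotient]; only the term with both derivatives on the twisted factor calls
    on the induction hypothesis. *)
Lemma second_derivation_quotient i j : (i <= j <= l)%N ->
  fraccong p (j - i) (map_mx D1 (map_mx D2 (A i j.+1))) (A i j.+1)
                     (map_mx D1 (map_mx D2 (A i j))) (A i j).
Proof.
move=> /andP[ij jl]; have [n] := ubnP (j - i); elim: n i ij => // n IH i ij ijn.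
have [->|ij'] := eqVneq i j; first by rewrite subnn; apply: fraccong0.
have [|B [C [Aij Aij1 Bdvd Cdvd]]] := A_expand (i := i) (j := j); first by lia.
rewrite {1}Aij {1}Aij1 (map_derivationD derD2) (map_derivationD derD1).
rewrite !(map_derivation_sum derD2) !(map_derivation_sum derD1).
rewrite -[X in fraccong _ _ _ _ X]addr0.
have Ddvd1 k (X : 'M[K]_g) : mxdvd p k X -> mxdvd p k (map_mx D1 X).
  exact: mxdvd_derivation.
have Ddvd2 k (X : 'M[K]_g) : mxdvd p k X -> mxdvd p k (map_mx D2 X).
  exact: mxdvd_derivation.
apply: fraccongD (fraccong_dvd _ _ (Ddvd1 _ _ (Ddvd2 _ _ Cdvd))).
apply: fraccong_sum => m; rewrite mem_index_iota => /andP[im mj].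
have -> : (j - i = (m - i.+1) + (j - m).+1)%N by lia.
have Bm : mxdvd p (m - i.+1) (B m) by apply: Bdvd; lia.
have imj : (i < m <= j)%N by lia.
have mjl : (m <= j <= l)%N by lia.
have [c1 ca1 Dphi1] := map_derivation_phi D1_phi (E i m).
have [c2 ca2 Dphi2] := map_derivation_phi D2_phi (E i m).
have cong1 := derivation_quotient derD1 D1_phi mjl.
have cong2 := derivation_quotient derD2 D2_phi mjl.
rewrite !(map_derivationM derD2) !(map_derivationD derD1) !(map_derivationM derD1).
do 2?[apply: fraccongD].
- apply: fraccongMl (Ddvd1 _ _ (Ddvd2 _ _ Bm)) _; exact: frobenius_quotient.
- apply: fraccongMl (Ddvd2 _ _ Bm) _; rewrite !Dphi1.
  exact: fraccong_scaled_phi.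
- apply: fraccongMl (Ddvd1 _ _ Bm) _; rewrite !Dphi2.
  exact: fraccong_scaled_phi.
(* The chain rule factor [c2] is differentiated too. [D1 c2] keeps the powers of [p] of [c2], so
   first derivatives suffice for that term. *)
apply: fraccongMl Bm _; rewrite !Dphi2 !(map_derivationZ derD1) !Dphi1.
apply: fraccongD.
  by apply: fraccong_scaled_phi => //; apply: pdvd_derivation.
rewrite !scalerA; apply: fraccong_scaled_phi => //; first exact: pdvdMr.
by apply: IH; lia.
Qed.

End TwoDerivations.
End DworkCongruences.

(** * Partial derivatives of Laurent polynomials *)

Section LaurentDerivation.
Variables (n : nat) (R : comNzRingType) (v : 'I_n).
Implicit Types F G : laurent n R.
Local Notation D := (@laurent_deriv n R v).
Local Notation delta := (delta_mx 0 v : 'rV[int]_n).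

(** Being free of [msupp], this form yields additivity and the value on monomials directly. *)
Lemma coef_laurent_deriv F k :
  (laurent_deriv v F)@_k = F@_(k + delta) *~ (k 0 v + 1).
Proof.
rewrite /laurent_deriv coef_sum; set d := k + delta.
have term m : (<< F@_m *~ m 0 v *g m - delta >> : laurent n R)@_k =
    (F@_m *~ m 0 v) *+ (m == d).
  by rewrite -lmon_def coef_lmon subr_eq.
have dv : d 0 v = k 0 v + 1 by rewrite !mxE !eqxx.
under eq_bigr do rewrite term.
case: (msuppP F d) => [dF|out].
  rewrite (bigD1_seq d) ?fset_uniq //= eqxx mulr1n dv big1 ?addr0 // => m md.
  by rewrite (negPf md).
rewrite mul0rz big_seq big1 // => m mF.
by case: eqP => // md; rewrite -md mF in out.
Qed.

Lemma laurent_derivD : {morph D : F G / F + G}.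
Proof.
move=> F G; apply: laurentP => k.
rewrite [LHS]coef_laurent_deriv [RHS]coefD [in LHS]coefD mulrzDl.
by congr (_ + _); exact/esym/coef_laurent_deriv.
Qed.

Lemma laurent_deriv_mon (c : R) m :
  laurent_deriv v (lmon c m) = lmon (c *~ m 0 v) (m - delta).
Proof.
apply: laurentP => k; rewrite coef_laurent_deriv !coef_lmon subr_eq.
case: eqP => [->|_]; last by rewrite mul0rz.
by rewrite !mxE !eqxx.
Qed.

Lemma derivation_laurent_deriv : derivation D.
Proof.
split=> [|F G]; first exact: laurent_derivD.
have leibnizl (K : comNzRingType) (a b h da db dh : K) :
  (da + db) * h + (a + b) * dh = (da * h + a * dh) + (db * h + b * dh) by ring.
have leibnizr (K : comNzRingType) (a b h da db dh : K) :
  dh * (a + b) + h * (da + db) = (dh * a + h * da) + (dh * b + h * db) by ring.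
(* Both sides of the Leibniz rule are additive in each factor, which leaves products of two
   monomials. *)
pose f G F := laurent_deriv v (F * G).
pose h G F := laurent_deriv v F * G + F * laurent_deriv v G.
have fD H : {morph f H : a b / a + b}.
  by move=> a b; rewrite /f (mulrDl a b H); exact: laurent_derivD.
have hD H : {morph h H : a b / a + b}.
  by move=> a b; rewrite /h (laurent_derivD a b); exact: leibnizl.
have f'D H : {morph f^~ H : a b / a + b}.
  by move=> a b; rewrite /f (mulrDr H a b); exact: laurent_derivD.
have h'D H : {morph h^~ H : a b / a + b}.
  by move=> a b; rewrite /h (laurent_derivD a b); exact: leibnizr.
apply: (lmon_ext (fD G) (hD G)) => a i {F}.
apply: (lmon_ext (f'D _) (h'D _)) => b j {G}.
rewrite /f /h (lmonM a b i j) (laurent_deriv_mon (a * b) (i + j)).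
rewrite (laurent_deriv_mon a i) (laurent_deriv_mon b j).
rewrite (lmonM (a *~ i 0 v) b) (lmonM a (b *~ j 0 v)).
rewrite addrAC [i + (j - _)]addrA [i - _ + j]addrAC -lmonD; congr lmon.
by rewrite !mxE mulrzDr -mulrzAl -mulrzAr.
Qed.

(** Chain rule with inner derivative [q z_v^(q-1)]; for [q = p ^ a] it yields the gain of [a]
    factors [p]. *)
Lemma laurent_deriv_lmap q F : (0 < q)%N ->
  laurent_deriv v (lmap idfun q F) =
    q%:R * lmon 1 (delta *+ q.-1) * lmap idfun q (laurent_deriv v F).
Proof.
move=> q0; have lmapD : {morph @lmap n R R idfun q : a b / a + b}.
  exact: raddfD.
pose f F := laurent_deriv v (lmap idfun q F).
pose h F := q%:R * lmon 1 (delta *+ q.-1) * lmap idfun q (laurent_deriv v F).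
have fD : {morph f : a b / a + b}.
  by move=> a b; rewrite /f (lmapD a b); exact: laurent_derivD.
have hD : {morph h : a b / a + b}.
  by move=> a b; rewrite /h (laurent_derivD a b) lmapD; exact: mulrDr.
apply: (lmon_ext fD hD) => c m {F}; rewrite /f /h.
rewrite (lmap_mon idfun q c m) (laurent_deriv_mon c m) lmap_mon laurent_deriv_mon.
rewrite -mulrA lmonM mul1r mulr_natl -lmonMn; congr lmon.
  by rewrite mulmxnE -mulr_natr mulrzA natz -pmulrn.
have dq : delta *+ q = delta *+ q.-1 + delta by rewrite -mulrSr prednK.
by rewrite mulrnBl addrCA dq opprD addNKr.
Qed.

End LaurentDerivation.

(** * Expansion of Dwork products *)

Section ExpSum.
Variable e : nat -> nat.

Lemma exp_sum_add i m j : (i <= m <= j)%N ->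
  (exp_sum e i m + exp_sum e m j)%N = exp_sum e i j.
Proof. by move=> /andP[im mj]; rewrite /exp_sum -big_cat_nat. Qed.

Lemma exp_sum_ge l i j : (forall k, (1 <= k <= l)%N -> (0 < e k)%N) ->
  (j <= l)%N -> (j - i <= exp_sum e i j)%N.
Proof.
move=> e_gt0 jl; rewrite /exp_sum -subSS -[X in (X <= _)%N]muln1 -sum_nat_const_nat.
rewrite big_seq [X in (_ <= X)%N]big_seq; apply: leq_sum => k.
by rewrite mem_index_iota => kij; apply: e_gt0; lia.
Qed.

End ExpSum.

Section DworkExpansion.
Variables (K : comNzRingType) (p l : nat) (e : nat -> nat) (Lambda : nat -> K).
Variable (phi : nat -> {rmorphism K -> K}).
(** [supp i j x] abstracts that the exponents of [x] in [t] lie in the Minkowski sum of the dilated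
    polytopes of index [i] to [j.-1]. *)
Variable supp : nat -> nat -> K -> Prop.
Local Notation E := (exp_sum e).

Definition dwork_interval i j := \prod_(i <= k < j) Lambda k ^+ (p ^ E i k).
Local Notation W := dwork_interval.

Hypothesis e_gt0 : forall i, (1 <= i <= l)%N -> (0 < e i)%N.
Hypothesis phi_comp : forall a b x, phi a (phi b x) = phi (a + b)%N x.
Hypothesis phi0 : forall x, phi 0 x = x.
Hypothesis phi1 : forall x, pdvd p 1 (x ^+ p - phi 1 x).
Hypothesis supp0 : forall i j, supp i j 0.
Hypothesis suppB : forall i j x y, supp i j x -> supp i j y -> supp i j (x - y).
Hypothesis suppW : forall i j, supp i j (W i j).
Hypothesis suppM : forall i m j x y, (i <= m <= j)%N ->
  supp i m x -> supp m j y -> supp i j (x * phi (E i m) y).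

Lemma dwork_intervalii i : W i i = 1.
Proof. by rewrite /W big_geq. Qed.

Lemma dwork_interval_recr i j : (i <= j)%N ->
  W i j.+1 = W i j * Lambda j ^+ (p ^ E i j).
Proof. by move=> ij; rewrite /W big_nat_recr. Qed.

Lemma dwork_interval_recl i j : (i < j)%N ->
  W i j = Lambda i * W i.+1 j ^+ (p ^ E i i.+1).
Proof.
move=> ij; rewrite /W big_ltn // {1}/exp_sum big_geq // expn0 expr1.
rewrite -prodrXl; congr (_ * _); rewrite big_seq [RHS]big_seq.
apply: eq_bigr => k; rewrite mem_index_iota => /andP[ik _].
by rewrite -exprM -expnD addnC exp_sum_add // ik leqnSn.
Qed.

Lemma expr_frobenius a x : pdvd p 1 (x ^+ (p ^ a) - phi a x).
Proof.
elim: a => [|a IH]; first by rewrite phi0 expn0 expr1 subrr; apply: pdvd0.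
rewrite expnSr exprM -[a.+1]add1n -phi_comp.
by apply: pdvd_trans (phi1 _); apply: pdvdBX; exact: IH.
Qed.

Lemma expr_frobeniusX a b x :
  pdvd p b.+1 (x ^+ (p ^ (a + b)) - phi a (x ^+ (p ^ b))).
Proof.
rewrite expnD exprM rmorphXn; apply: pdvd_exprpX; exact: expr_frobenius.
Qed.

Lemma dwork_interval1 i : W i i.+1 = Lambda i.
Proof. by rewrite dwork_interval_recl // dwork_intervalii expr1n mulr1. Qed.

(** This one-step factorization modulo [p] serves to show that the determinants do not vanish modulo
    [p]. *)
Lemma dwork_interval_frobenius i j : (i < j)%N ->
  pdvd p 1 (W i j - W i i.+1 * phi (E i i.+1) (W i.+1 j)).
Proof.
move=> ij; rewrite dwork_interval1 dwork_interval_recl // -mulrBr.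
by apply: pdvdMl; exact: expr_frobenius.
Qed.

(** Multiply the expansion of [W i j] by the last factor of [W i j.+1]. In the term of index [m]
    this compares a [p ^ E i j]-th power with the twist of a [p ^ E m j]-th power; they agree modulo
    [p ^ (E m j).+1], and [E m j >= j - m] as all exponents are positive. *)
Lemma dwork_remainder i j (Q : nat -> K) : (i < j <= l)%N ->
  W i j = \sum_(i.+1 <= m < j.+1) Q m * phi (E i m) (W m j) ->
  (forall m, (i < m <= j)%N -> pdvd p (m - i.+1) (Q m)) ->
  pdvd p (j - i)
    (W i j.+1 - \sum_(i.+1 <= m < j.+1) Q m * phi (E i m) (W m j.+1)).
Proof.
move=> /andP[ij jl] Wij Qdvd; rewrite dwork_interval_recr ?(ltnW ij) // Wij.
rewrite mulr_suml -sumrB big_seq; apply: pdvd_sum => m.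
rewrite mem_index_iota => /andP[im mj]; rewrite dwork_interval_recr // rmorphM.
rewrite mulrA -mulrBr -(@exp_sum_add e i m j) ?(ltnW im) //.
have -> : (j - i = (m - i.+1) + (j - m).+1)%N by lia.
apply: pdvdM; first by apply: pdvdMr; apply: Qdvd; rewrite im.
apply: pdvd_leq (expr_frobeniusX _ _ _); rewrite ltnS.
exact: exp_sum_ge e_gt0 jl.
Qed.

Lemma supp_remainder i j (Q : nat -> K) : (i < j)%N ->
  (forall m, (i < m <= j)%N -> supp i m (Q m)) ->
  supp i j.+1
    (W i j.+1 - \sum_(i.+1 <= m < j.+1) Q m * phi (E i m) (W m j.+1)).
Proof.
move=> ij Qsupp; apply: suppB => //; rewrite big_seq.
elim/big_ind: _ => //= [x y xs ys|m].
  by rewrite -[y]opprK -(sub0r y); do !apply: suppB.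
rewrite mem_index_iota => mij; apply: suppM => //; first by lia.
by apply: Qsupp; lia.
Qed.

(** Induction on [j]: the coefficients already found are kept, and since [W j.+1 j.+1 = 1] the
    defect [q] of the old expansion can serve as the new coefficient. *)
Lemma dwork_expansion i j : (i < j <= l)%N ->
  exists Q : nat -> K,
  [/\ W i j = \sum_(i.+1 <= m < j.+1) Q m * phi (E i m) (W m j),
      forall m, (i < m <= j)%N -> pdvd p (m - i.+1) (Q m) &
      forall m, (i < m <= j)%N -> supp i m (Q m)].
Proof.
elim: j => [|j IH]; first by rewrite ltn0.
rewrite ltnS leq_eqVlt => /andP[/predU1P[<- il|ij jl]].
  exists (fun m => W i m); rewrite big_nat1 dwork_intervalii rmorph1 mulr1.
  split=> // m /andP[im mi]; have -> : m = i.+1 by lia.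
  by rewrite subnn; apply: pdvdk0.
have [|Q [Wij Qdvd Qsupp]] := IH; first by rewrite ij ltnW.
pose q := W i j.+1 - \sum_(i.+1 <= m < j.+1) Q m * phi (E i m) (W m j.+1).
exists (fun m => if (m <= j)%N then Q m else q); split.
- rewrite big_nat_recr; last by lia.
  rewrite ltnn dwork_intervalii rmorph1 mulr1 /= /q addrC.
  rewrite [X in _ = _ + X](_ : _ = \sum_(i.+1 <= m < j.+1) Q m * phi (E i m) (W m j.+1)).
    by rewrite subrK.
  rewrite big_seq [RHS]big_seq; apply: eq_bigr => m.
  by rewrite mem_index_iota ltnS => /andP[_ ->].
- move=> m mij; case: leqP => mj; first by apply: Qdvd; lia.
  have -> : m = j.+1 by lia.
  by rewrite subSS; apply: dwork_remainder => //; lia.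
- move=> m mij; case: leqP => mj; first by apply: Qsupp; lia.
  have -> : m = j.+1 by lia.
  exact: supp_remainder.
Qed.

End DworkExpansion.

(** * Newton polytopes *)

Section Supports.
Local Open Scope classical_set_scope.
Variables (R : realType) (r : nat) (S : comNzRingType).
Implicit Types (F G : laurent r S) (X Y : set 'rV[R]_r) (m : 'rV[int]_r).
Local Notation int_point := (@int_point R r).
Local Notation newton := (@newton_polytope R r S).

Lemma int_pointD m k : int_point (m + k) = int_point m + int_point k.
Proof. exact: map_mxD. Qed.

Lemma int_point0 : int_point 0 = 0.
Proof. exact: map_mx0. Qed.

Lemma int_pointMn m q : int_point (m *+ q) = int_point m *+ q.
Proof. exact: (raddfMn (map_mx intr)). Qed.

Lemma int_point_inj : injective int_point.
Proof.
move=> m k /rowP mk; apply/rowP => i.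
by have := mk i; rewrite !mxE => /intr_inj.
Qed.

Definition supported F X := forall m, m \in msupp F -> X (int_point m).

Lemma supported0 X : supported 0 X.
Proof. by move=> m; rewrite msupp0. Qed.

Lemma supportedB F G X : supported F X -> supported G X -> supported (F - G) X.
Proof.
move=> FX GX m /(fsubsetP (msuppB_le F G)).
by rewrite in_fsetU => /orP[/FX|/GX].
Qed.

Lemma supported1 : supported 1 [set 0].
Proof.
move=> m; rewrite -mcoeff_neq0 coef1; have [-> _|_] := eqVneq m 0; last by rewrite eqxx.
by rewrite int_point0.
Qed.

Lemma supportedM F G X Y :
  supported F X -> supported G Y -> supported (F * G) (minkowski_sum X Y).
Proof.
move=> FX GY m; rewrite -mcoeff_neq0 coefM => nz.
have [k [kF kG]] : exists k, k \in msupp F /\ m - k \in msupp G.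
  apply: contrapT => all; case/negP: nz; rewrite big_seq big1 // => k kF.
  case: (msuppP G (m - k)) => [kG|_]; last by rewrite mulr0.
  by case: all; exists k.
exists (int_point k); first exact: FX.
by exists (int_point (m - k)); [exact: GY|rewrite -int_pointD addrC subrK].
Qed.

Lemma supported_prod (s : seq nat) (F : nat -> laurent r S)
    (X : nat -> set 'rV[R]_r) :
  (forall k, supported (F k) (X k)) ->
  supported (\prod_(k <- s) F k) (\big[@minkowski_sum R r/[set 0]]_(k <- s) X k).
Proof.
move=> FX; elim: s => [|k s IH]; first by rewrite !big_nil; exact: supported1.
by rewrite !big_cons; apply: supportedM.
Qed.

(** As the indices are distinct, the summands can be collected in a function of the index. *)
Lemma big_minkowskiP (s : seq nat) (X : nat -> set 'rV[R]_r) x : uniq s ->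
  (\big[@minkowski_sum R r/[set 0]]_(k <- s) X k) x <->
  exists c, (forall k, k \in s -> X k (c k)) /\ x = \sum_(k <- s) c k.
Proof.
elim: s x => [|a s IH] x /=.
  move=> _; rewrite big_nil; split=> [->|[c [_ ->]]]; last by rewrite big_nil.
  by exists (fun=> 0); rewrite big_nil.
move=> /andP[as_ us]; rewrite big_cons; split.
  move=> [y Xy [z /(IH _ us)[c [Xc ->]] <-]].
  exists (fun k => if k == a then y else c k); split.
    move=> k; rewrite inE; case: eqVneq => [->//|_] /=; exact: Xc.
  rewrite big_cons eqxx; congr (_ + _); rewrite big_seq [RHS]big_seq.
  by apply: eq_bigr => k ks; case: eqP => // ka; rewrite -ka ks in as_.
move=> [c [Xc ->]]; rewrite big_cons.
exists (c a); first by apply: Xc; rewrite mem_head.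
exists (\sum_(k <- s) c k) => //; apply/(IH _ us).
by exists c; split=> // k ks; apply: Xc; rewrite inE ks orbT.
Qed.

Lemma supported_newton F : supported F (newton F).
Proof. by move=> m mF; apply: sub_gen_smallest; exists m. Qed.

Lemma newton_convex F (x y : 'rV[R]_r) (t : R) : 0 <= t -> t <= 1 ->
  newton F x -> newton F y ->
  newton F (t *: x + (1 - t) *: y).
Proof.
move=> t0 t1 Fx Fy C [Ccvx CF].
have Cx := Fx C (conj Ccvx CF); have Cy := Fy C (conj Ccvx CF).
have := Ccvx x y (Itv01 t0 t1).
by rewrite !inE; apply.
Qed.

(** A sum of [q] points of a convex set is [q] times their barycentre, formed one point at a time.
    Positivity matters: for [F = 0] the polytope is empty, while [F ^+ 0 = 1]. *)
Lemma supportedX F q : (0 < q)%N ->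
  supported (F ^+ q) (dilate q (newton F)).
Proof.
case: q => // q _; elim: q => [|q IH] m.
  by rewrite expr1 => mF; exists (int_point m); [exact: supported_newton|].
rewrite exprS => /(supportedM (@supported_newton F) IH)[a Fa [_ [b Fb <-] <-]].
have q2 : (q.+2%:R : R) != 0 by rewrite pnatr_eq0.
exists (q.+2%:R^-1 *: a + (1 - q.+2%:R^-1) *: b).
  apply: newton_convex => //.
  by rewrite invf_le1 ?ler1n ?ltr0n.
rewrite -scaler_nat scalerDr !scalerA divff // scale1r mulrBr mulr1 divff //.
by rewrite -[q.+2]addn1 natrD addrK scaler_nat.
Qed.

Lemma supported_lmap (f : {rmorphism S -> S}) q F X :
  supported F X -> supported (lmap f q F) (dilate q X).
Proof.
move=> FX m /msupp_lmap[k kF ->]; rewrite int_pointMn.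
by exists (int_point k); [exact: FX|].
Qed.

(** The twist dilates the polytopes of [G] by [p ^ exp_sum e i m], turning the factor
    [p ^ exp_sum e m k] into [p ^ exp_sum e i k]; the two ranges of indices are then
    concatenated. *)
Lemma supported_twisted (p : nat) (e : nat -> nat) (N : nat -> set 'rV[R]_r)
    (f : {rmorphism S -> S}) (i m j : nat) F G : (i <= m <= j)%N ->
  supported F (\big[@minkowski_sum R r/[set 0]]_(i <= k < m)
                 dilate (p ^ exp_sum e i k) (N k)) ->
  supported G (\big[@minkowski_sum R r/[set 0]]_(m <= k < j)
                 dilate (p ^ exp_sum e m k) (N k)) ->
  supported (F * lmap f (p ^ exp_sum e i m) G)
    (\big[@minkowski_sum R r/[set 0]]_(i <= k < j)
       dilate (p ^ exp_sum e i k) (N k)).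
Proof.
move=> /andP[im mj] FX GY k.
move/(supportedM FX (@supported_lmap f (p ^ exp_sum e i m) G _ GY)).
move=> [a /(big_minkowskiP _ _ (iota_uniq _ _))[c [Xc ->]]].
move=> [_ [b /(big_minkowskiP _ _ (iota_uniq _ _))[d [Yd ->]] <-] <-].
apply/(big_minkowskiP _ _ (iota_uniq _ _)).
exists (fun t => if (t < m)%N then c t else d t *+ p ^ exp_sum e i m); split.
  move=> t; rewrite mem_index_iota => /andP[it tj]; case: ltnP => tm.
    by apply: Xc; rewrite mem_index_iota it.
  have [|x Nx <-] := Yd t; first by rewrite mem_index_iota tm.
  exists x => //; rewrite -mulrnA -expnD addnC exp_sum_add //.
  by rewrite im.
rewrite [RHS](big_cat_nat im mj) /= -sumrMnl; congr (_ + _).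
  rewrite big_seq [RHS]big_seq; apply: eq_bigr => t.
  by rewrite mem_index_iota => /andP[_ ->].
rewrite big_seq [RHS]big_seq; apply: eq_bigr => t.
by rewrite mem_index_iota => /andP[mt _]; rewrite ltnNge mt.
Qed.

End Supports.

(** * Hasse-Witt matrices *)

Lemma coefM_lmap r (S : comNzRingType) (f : {rmorphism S -> S}) q
    (F G : laurent r S) m :
  (F * lmap f q G)@_m = \sum_(k <- msupp G) f G@_k * F@_(m - k *+ q).
Proof.
rewrite mulrC /lmap mulr_suml coef_sum.
by apply: eq_bigr => k _; rewrite coef_lmonM.
Qed.

Lemma coefM_lmap_tuple r (S : comNzRingType) (f : {rmorphism S -> S}) q g
    (D : g.-tuple 'rV[int]_r) (F G : laurent r S) (u c : 'rV[int]_r) :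
  uniq D -> (forall w, F@_(w *+ q - u) != 0 -> w \in D) ->
  (F * lmap f q G)@_(c *+ q - u) =
    \sum_(j < g) F@_(tnth D j *+ q - u) * f G@_(c - tnth D j).
Proof.
move=> Du FD; pose h w := F@_(w *+ q - u).
(* As [h] vanishes outside [D], whose entries are distinct, it is a sum of delta functions; this
   converts a sum over the support of [G] into one over [D]. *)
have hE w : h w = \sum_(j < g) h (tnth D j) *+ (tnth D j == w).
  case wD : (w \in D).
    have /tnthP[j wj] := wD; rewrite (bigD1 j) //= wj eqxx mulr1n big1 ?addr0 // => i ij.
    by rewrite (inj_eq (elimT (tuple_uniqP _) Du)) (negPf ij).
  rewrite big1 => [|j _]; first by apply/eqP; apply: contraFT wD => /FD.
  by case: eqP wD => // <-; rewrite mem_tnth.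
rewrite coefM_lmap; under eq_bigr => w _.
  rewrite (_ : _ - w *+ q = (c - w) *+ q - u); last first.
    by rewrite mulrnBl addrAC.
  rewrite -/(h (c - w)) hE mulr_sumr; over.
rewrite exchange_big; apply: eq_bigr => j _; rewrite /= -/(h (tnth D j)).
have sw w : (tnth D j == c - w) = (w == c - tnth D j).
  by rewrite eq_sym subr_eq addrC -subr_eq eq_sym.
under eq_bigr do rewrite sw.
case: (msuppP G (c - tnth D j)) => [wG|out].
  rewrite (bigD1_seq (c - tnth D j)) ?fset_uniq //= eqxx mulr1n mulrC.
  by rewrite big1 ?addr0 // => w /negPf->; rewrite mulr0.
rewrite rmorph0 mulr0 big_seq big1 // => w wG.
by case: eqP => [wE|_]; [rewrite -wE wG in out|rewrite mulr0].
Qed.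

Lemma mxB_coef (V : zmodType) m n (X Y : 'M[V]_(m, n)) i j :
  (X - Y) i j = X i j - Y i j.
Proof. by rewrite !mxE. Qed.

Section FrobeniusTwists.
Variables (r n p : nat).

Definition zfrob a : {rmorphism laurent n (padic_int p) -> laurent n (padic_int p)} :=
  @lmap n _ _ (idfun : padic_int p -> padic_int p) (p ^ a).

Definition tfrob a : {rmorphism laurent2 r n p -> laurent2 r n p} :=
  @lmap r _ _ (zfrob a) (p ^ a).

Hypothesis p_prime : prime p.

Lemma zfrob_comp a b x : zfrob a (zfrob b x) = zfrob (a + b) x.
Proof. by rewrite /zfrob /= expnD mulnC; apply: lmap_comp. Qed.

Lemma tfrob_comp a b x : tfrob a (tfrob b x) = tfrob (a + b) x.
Proof. by rewrite /tfrob /= expnD mulnC; apply: lmap_comp; exact: zfrob_comp. Qed.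

Lemma lmap_id k (S : nzRingType) (f : {rmorphism S -> S}) (F : laurent k S) :
  f =1 id -> lmap f 1 F = F.
Proof.
by move=> fid; rewrite [RHS]lmonE; apply: eq_bigr => m _; rewrite fid mulr1n.
Qed.

Lemma zfrob0 x : zfrob 0 x = x.
Proof. exact: lmap_id. Qed.

Lemma tfrob0 x : tfrob 0 x = x.
Proof. apply: lmap_id; exact: zfrob0. Qed.

Lemma zfrob1 x : pdvd p 1 (x ^+ p - zfrob 1 x).
Proof.
by rewrite /zfrob expn1; apply: lmap_frobenius => //; exact: padic_fermat.
Qed.

Lemma tfrob1 x : pdvd p 1 (x ^+ p - tfrob 1 x).
Proof. rewrite /tfrob expn1; apply: lmap_frobenius => //; exact: zfrob1. Qed.

Lemma zfrob_derivation v a : exists2 c, pdvd p a c & forall x,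
  laurent_deriv v (zfrob a x) = c * zfrob a (laurent_deriv v x).
Proof.
exists ((p ^ a)%:R * lmon 1 (delta_mx 0 v *+ (p ^ a).-1)).
  by apply: pdvdMr; rewrite natrX; apply: pdvd_expp.
by move=> x; apply: laurent_deriv_lmap; rewrite expn_gt0 prime_gt0.
Qed.

Lemma zfrob_nonzero_mod a F : ~ pdvd p 1 F -> ~ pdvd p 1 (zfrob a F).
Proof.
move=> nF /pdvd_laurent aF; apply: nF; apply/pdvd_laurent => m.
by have := aF (m *+ p ^ a); rewrite coef_lmap // expn_gt0 prime_gt0.
Qed.

Lemma nonzero_modE (F : laurent n (padic_int p)) :
  nonzero_mod F <-> ~ pdvd p 1 F.
Proof.
rewrite pdvd_laurent; split=> nF F0; apply: nF => m; have := F0 m;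
  by rewrite /padic_congr coef0 subr0.
Qed.

Lemma pregular_nonzero_mod (F : laurent n (padic_int p)) :
  ~ pdvd p 1 F -> pregular p F.
Proof.
move=> nF; apply: pdvd_laurent_regular nF.
  exact: padic_mulp_eq0.
exact: pdvd1_padicM.
Qed.

Lemma quotient_congrE s g (F1 F2 G1 G2 : 'M[laurent n (padic_int p)]_g) :
  ~ pdvd p 1 (\det F2) -> ~ pdvd p 1 (\det G2) ->
  fraccong p s F1 F2 G1 G2 -> quotient_congr s F1 F2 G1 G2.
Proof.
move=> /nonzero_modE F2nz /nonzero_modE G2nz FG; split=> // i j m.
have /pdvd_laurent/(_ m) := FG i j; rewrite mxB_coef coefB; exact.
Qed.

End FrobeniusTwists.

Section HasseWitt.
Variables (r n p : nat).
Implicit Types F G : laurent2 r n p.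

Lemma hasse_wittD m g1 g2 (D1 : g1.-tuple 'rV[int]_r) (D2 : g2.-tuple 'rV[int]_r) F G :
  hasse_witt m D1 D2 (F + G) = hasse_witt m D1 D2 F + hasse_witt m D1 D2 G.
Proof. by apply/matrixP => i j; rewrite !mxE coefD. Qed.

Lemma hasse_witt_sum m g1 g2 (D1 : g1.-tuple 'rV[int]_r) (D2 : g2.-tuple 'rV[int]_r)
    (s : seq nat) (F : nat -> laurent2 r n p) :
  hasse_witt m D1 D2 (\sum_(k <- s) F k) = \sum_(k <- s) hasse_witt m D1 D2 (F k).
Proof.
apply/matrixP => i j; rewrite !mxE coef_sum summxE.
by apply: eq_bigr => k _; rewrite mxE.
Qed.

Lemma mxdvd_hasse_witt k m g (D1 D2 : g.-tuple 'rV[int]_r) F :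
  pdvd p k F -> mxdvd p k (hasse_witt m D1 D2 F).
Proof. by move=> /pdvd_laurent Fk i j; rewrite mxE. Qed.

Lemma hasse_witt1 g (D : g.-tuple 'rV[int]_r) : uniq D ->
  hasse_witt 0 D D (1 : laurent2 r n p) = 1%:M.
Proof.
move=> Du; apply/matrixP => i j.
by rewrite !mxE coef1 mulr1n subr_eq0 (inj_eq (elimT (tuple_uniqP _) Du)) eq_sym.
Qed.

(** The exponent [p^(a+b) v - u] splits as [(p^a w - u) + p^a (p^b v - w)], and the support
    condition confines [w] to [D2], the index set of the matrix product. *)
Lemma hasse_witt_mul a b g1 g2 g3 (D1 : g1.-tuple 'rV[int]_r)
    (D2 : g2.-tuple 'rV[int]_r) (D3 : g3.-tuple 'rV[int]_r) F G :
  uniq D2 ->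
  (forall u w, u \in D1 -> F@_(w *+ p ^ a - u) != 0 -> w \in D2) ->
  hasse_witt (a + b) D1 D3 (F * tfrob r n p a G) =
    hasse_witt a D1 D2 F *m map_mx (zfrob n p a) (hasse_witt b D2 D3 G).
Proof.
move=> D2u FD; apply/matrixP => i j; rewrite !mxE.
rewrite addnC expnD mulrnA.
rewrite (coefM_lmap_tuple _ _ _ D2u); last by move=> w; apply: FD; exact: mem_tnth.
by apply: eq_bigr => k _; rewrite !mxE.
Qed.

End HasseWitt.

Lemma pdvdB_prod (K : comNzRingType) p k g (x y : 'I_g -> K) :
  (forall i, pdvd p k (x i - y i)) ->
  pdvd p k (\prod_(i < g) x i - \prod_(i < g) y i).
Proof.
move=> xy; elim/big_ind2: _ => // [|x1 y1 x2 y2].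
  by rewrite subrr; apply: pdvd0.
exact: pdvdBM.
Qed.

Lemma pdvdB_det (K : comNzRingType) p k g (X Y : 'M[K]_g) :
  mxdvd p k (X - Y) -> pdvd p k (\det X - \det Y).
Proof.
move=> XY; rewrite /determinant -sumrB; apply: pdvd_sum => s _.
rewrite -mulrBr; apply: pdvdMl; apply: pdvdB_prod => i.
by rewrite -mxB_coef; exact: XY.
Qed.

(** * Hasse-Witt matrices of a Dwork product *)

Section DworkHasseWitt.
Variables (R : realType) (p : nat) (r n l g : nat) (e : nat -> nat).
Variables (Delta : nat -> g.-tuple 'rV[int]_r) (Lambda : nat -> laurent2 r n p).
Hypothesis p_prime : prime p.
Hypothesis e_gt0 : forall i : nat, (1 <= i <= l.+1)%N -> (0 < e i)%N.
Hypothesis Delta_uniq : forall i : nat, (i <= l.+1)%N -> uniq (Delta i).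
Hypothesis Lambda_admissible : admissible R l Delta e Lambda.
Hypothesis hasse_witt_nonzero : forall i : nat, (i <= l)%N ->
  nonzero_mod (\det (hasse_witt (e i.+1) (Delta i) (Delta i.+1) (Lambda i))).

Local Notation E := (exp_sum e).
Local Notation W := (dwork_interval p e Lambda).
Local Notation zf := (zfrob n p).
Local Notation tf := (tfrob r n p).

Definition newton_sum i j : set 'rV[R]_r :=
  (\big[@minkowski_sum R r/[set 0]]_(i <= k < j)
     dilate (p ^ E i k) (@newton_polytope R r _ (Lambda k)))%classic.

Definition dwork_hasse_witt i j :=
  hasse_witt (E i j) (Delta i) (Delta j) (W i j).
Local Notation A := dwork_hasse_witt.

Let p_gt0 a : (0 < p ^ a)%N. Proof. by rewrite expn_gt0 prime_gt0. Qed.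

Lemma supported_dwork i j : supported (W i j) (newton_sum i j).
Proof. by apply: supported_prod => k; apply: supportedX. Qed.

(** Admissibility enters here, for the indices [i] and [m.-1]: [w *+ p ^ E i m] is [u] plus an
    exponent of [F], so it belongs to the Minkowski sum as well as to the dilated lattice. *)
Lemma admissible_coef i m (F : laurent2 r n p) : (i < m <= l)%N ->
  supported F (newton_sum i m) ->
  forall u w, u \in (Delta i : seq _) -> F@_(w *+ p ^ E i m - u) != 0 ->
    w \in (Delta m : seq _).
Proof.
case: m => // m /andP[im ml] FN u w ui; rewrite mcoeff_neq0 => /FN Fwu.
have im' : (i <= m < l)%N by lia.
have [] := Lambda_admissible im' (conj _ _) (t := int_point R (w *+ p ^ E i m.+1)).
- exists (int_point R u); first by exists u.
  exists (int_point R (w *+ p ^ E i m.+1 - u)) => //.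
  by rewrite -int_pointD addrC subrK.
- by exists (int_point R w); [exists w|rewrite int_pointMn].
move=> _ [d dD <-]; rewrite -int_pointMn => /int_point_inj dw.
suff -> : w = d by [].
apply/rowP => k; apply/eqP; move/rowP/(_ k)/eqP: dw.
by rewrite !mulmxnE eqrMn2r eqn0Ngt p_gt0 eq_sym.
Qed.

Lemma dwork_hasse_witt_mul i m j (F : laurent2 r n p) : (i < m <= j)%N ->
  (m <= l)%N -> supported F (newton_sum i m) ->
  hasse_witt (E i j) (Delta i) (Delta j) (F * tf (E i m) (W m j)) =
    hasse_witt (E i m) (Delta i) (Delta m) F *m map_mx (zf (E i m)) (A m j).
Proof.
move=> imj ml FN; rewrite -(@exp_sum_add e i m j); last by lia.
apply: hasse_witt_mul; first by apply: Delta_uniq; lia.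
by apply: admissible_coef => //; lia.
Qed.

Lemma dwork_hasse_witt_expand i j : (i < j <= l)%N ->
  exists (B : nat -> 'M[laurent n (padic_int p)]_g) C,
  [/\ A i j = \sum_(i.+1 <= m < j.+1) B m *m map_mx (zf (E i m)) (A m j),
      A i j.+1 = \sum_(i.+1 <= m < j.+1) B m *m map_mx (zf (E i m)) (A m j.+1) + C,
      forall m, (i < m <= j)%N -> mxdvd p (m - i.+1) (B m) &
      mxdvd p (j - i) C].
Proof.
move=> ij.
have e_gt0' k : (1 <= k <= l)%N -> (0 < e k)%N by move=> kl; apply: e_gt0; lia.
have [Q [WQ Qdvd Qsupp]] : exists Q : nat -> laurent2 r n p,
    [/\ W i j = \sum_(i.+1 <= m < j.+1) Q m * tf (E i m) (W m j),
        forall m, (i < m <= j)%N -> pdvd p (m - i.+1) (Q m) &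
        forall m, (i < m <= j)%N -> supported (Q m) (newton_sum i m)].
  apply: (dwork_expansion (l := l) (phi := tf)
    (supp := fun i j F => supported F (newton_sum i j))) => //.
  - exact: tfrob_comp.
  - exact: tfrob0.
  - exact: tfrob1.
  - by move=> *; apply: supported0.
  - by move=> *; apply: supportedB.
  - exact: supported_dwork.
  - by move=> i1 m1 j1 x y imj1 xN yN; apply: supported_twisted.
exists (fun m => hasse_witt (E i m) (Delta i) (Delta m) (Q m)).
exists (hasse_witt (E i j.+1) (Delta i) (Delta j.+1)
  (W i j.+1 - \sum_(i.+1 <= m < j.+1) Q m * tf (E i m) (W m j.+1))).
(* Taken at [k = j] and at [k = j.+1], this gives both expansions the same coefficients. *)
have expand k : (j <= k)%N ->
    hasse_witt (E i k) (Delta i) (Delta k)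
      (\sum_(i.+1 <= m < j.+1) Q m * tf (E i m) (W m k)) =
    \sum_(i.+1 <= m < j.+1)
      hasse_witt (E i m) (Delta i) (Delta m) (Q m) *m map_mx (zf (E i m)) (A m k).
  move=> jk; rewrite hasse_witt_sum big_seq [RHS]big_seq; apply: eq_bigr => m.
  rewrite mem_index_iota => imj; apply: dwork_hasse_witt_mul; [lia|lia|].
  by apply: Qsupp; lia.
split.
- by rewrite -expand // -WQ.
- by rewrite -expand // -hasse_wittD addrC subrK.
- by move=> m imj; apply: mxdvd_hasse_witt; apply: Qdvd.
- apply: mxdvd_hasse_witt.
  exact: (dwork_remainder e_gt0' (@tfrob_comp r n p) (@tfrob0 r n p)
    (tfrob1 p_prime) ij WQ Qdvd).
Qed.

(** Modulo [p], [A i j] is the product of the matrix of [Lambda i] and a twist of [A i.+1 j], so the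
    claim follows by induction on [j - i], [p] being prime in the ring of Laurent polynomials. *)
Lemma det_dwork_hasse_witt i j : (i <= j <= l.+1)%N -> ~ pdvd p 1 (\det (A i j)).
Proof.
move=> /andP[ij jl]; have [d] := ubnP (j - i); elim: d i ij => // d IH i ij jid.
have [->|ij'] := eqVneq i j.
  rewrite /A /exp_sum big_geq // dwork_intervalii hasse_witt1 ?Delta_uniq // det1.
  move=> /pdvd_laurent/(_ 0); rewrite coef1 eqxx => /(pdvd1_padicE p_prime).
  move/eqP; rewrite padic_val_nat (Zp_natr_eq0 p_prime) dvdn1.
  by rewrite -[1%N](expn0 p) eqn_exp2l ?prime_gt1.
have ltij : (i < j)%N by lia.
have Asucc : A i i.+1 = hasse_witt (e i.+1) (Delta i) (Delta i.+1) (Lambda i).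
  by rewrite /A dwork_interval1 {1}/exp_sum big_nat1.
have Asucc_nz : ~ pdvd p 1 (\det (A i i.+1)).
  rewrite Asucc; apply/nonzero_modE; apply: hasse_witt_nonzero; lia.
have [<-//|ij1] := eqVneq i.+1 j.
have ne : ~ pdvd p 1 (\det (A i i.+1 *m map_mx (zf (E i i.+1)) (A i.+1 j))).
  rewrite det_mulmx det_map_mx => /(pdvd1_laurentM (@pdvd1_padicM p p_prime))[//|].
  apply: (zfrob_nonzero_mod p_prime).
  by apply: IH; lia.
move=> Anz; apply: ne.
apply: (pdvd_congr _ Anz); apply: pdvdB_det.
have Ai : supported (W i i.+1) (newton_sum i i.+1) by exact: supported_dwork.
rewrite -(dwork_hasse_witt_mul _ _ Ai); [|lia|lia].
have hB m g1 g2 (D1 : g1.-tuple 'rV[int]_r) (D2 : g2.-tuple 'rV[int]_r) F G :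
    hasse_witt m D1 D2 F - hasse_witt m D1 D2 G =
    hasse_witt m D1 D2 (F - G : laurent2 r n p).
  by apply/eqP; rewrite subr_eq -hasse_wittD subrK.
rewrite hB; apply: mxdvd_hasse_witt.
exact: (dwork_interval_frobenius e Lambda (@tfrob_comp r n p) (@tfrob0 r n p)
  (tfrob1 p_prime) ltij).
Qed.

End DworkHasseWitt.

Theorem theorem2p9 (R : realType) (p : nat) (p_prime : prime p) (p_odd : odd p)
    (r n l g : nat) (g_gt0 : (0 < g)%N)
    (e : nat -> nat)
    (e_gt0 : forall i : nat, (1 <= i <= l.+1)%N -> (0 < e i)%N)
    (Delta : nat -> g.-tuple 'rV[int]_r)
    (Delta_uniq : forall i : nat, (i <= l.+1)%N -> uniq (Delta i))
    (Lambda : nat -> laurent2 r n p)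
    (Lambda_admissible : admissible R l Delta e Lambda)
    (hasse_witt_nonzero : forall i : nat, (i <= l)%N ->
       nonzero_mod (\det (hasse_witt (e i.+1) (Delta i) (Delta i.+1)
                            (Lambda i)))) :
  let W := dwork_product e Lambda in
  forall (u v : 'I_n) (s : nat), (1 <= s <= l)%N ->
    let A := hasse_witt (\sum_(1 <= a < s.+2) e a)%N
               (Delta 0%N) (Delta s.+1) (W s) in
    let B := hasse_witt (\sum_(1 <= a < s.+1) e a)%N
               (Delta 0%N) (Delta s) (W s.-1) in
    quotient_congr s
      (map_mx (laurent_deriv u) (map_mx (laurent_deriv v) A)) A
      (map_mx (laurent_deriv u) (map_mx (laurent_deriv v) B)) B.
Proof.
move=> W u v s /andP[s_gt0 sl] A B.
(* [W k] includes the factor of index [k], whereas the upper end of an interval is excluded. *)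
have WE k : W k = dwork_interval p e Lambda 0 k.+1.
  by rewrite /W /dwork_product /dwork_interval big_mkord.
have AE : A = dwork_hasse_witt e Delta Lambda 0 s.+1.
  by rewrite /A WE.
have BE : B = dwork_hasse_witt e Delta Lambda 0 s.
  by rewrite /B WE prednK.
have det_nz i j : (i <= j <= l.+1)%N ->
    ~ pdvd p 1 (\det (dwork_hasse_witt e Delta Lambda i j)).
  exact: (det_dwork_hasse_witt p_prime Delta_uniq Lambda_admissible).
rewrite AE BE; apply: quotient_congrE; [by apply: det_nz; lia|by apply: det_nz; lia|].
(* The modulus [s] is [j - i] for [i = 0] and [j = s]. *)
rewrite -[X in fraccong _ X]subn0.
apply: (second_derivation_quotient (l := l) (phi := zfrob n p) (E := exp_sum e)).
- exact: zfrob_comp.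
- by move=> i m j; apply: exp_sum_add.
- move=> i j ij; have := exp_sum_ge i e_gt0 (j := j); lia.
- move=> a i j ij; apply: (pregular_nonzero_mod p_prime).
  by rewrite det_map_mx; apply: (zfrob_nonzero_mod p_prime); exact: det_nz.
- exact: (dwork_hasse_witt_expand p_prime e_gt0 Delta_uniq Lambda_admissible).
- exact: derivation_laurent_deriv.
- exact: derivation_laurent_deriv.
- exact: (zfrob_derivation p_prime).
- exact: (zfrob_derivation p_prime).
- by [].
Qed.
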